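(* Let $\mu$ be a log-concave probability measure on $\mathbb{R}$, symmetric with respect to the origin, with density $f$ that is positive on an open interval $(a_f,b_f)$ and zero outside it. Assume that there exists $\varepsilon>0$ such that $t\mapsto J_\mu(t)/t$ is (strictly) decreasing on $(0,\varepsilon)$. Then the asymmetry goes to zero as the isoperimetric deficit goes to zero: for every sequence $(\Omega_n)$ of measurable subsets of $\mathbb{R}$ with $\delta_\mu(\Omega_n)\to0$, one has $\lambda_\mu(\Omega_n)\to0$.
   Context: Measure: $f$ is the density of $\mu$ with respect to Lebesgue measure $\mathcal{L}^1$; $a_f,b_f$ may be infinite; log-concave means $f=e^{-V}$ on $(a_f,b_f)$ with $V$ convex; symmetric means $f(-x)=f(x)$. Perimeter: for measurable $\Omega\subset\mathbb{R}$ and $d\in[0,1]$, $\Omega^d$ is the set of $x\in\mathbb{R}$ such that $\lim_{\rho\to0}\mathcal{L}^1(\Omega\cap B_\rho(x))/\mathcal{L}^1(B_\rho(x))=d$, where $B_\rho(x)=(x-\rho,x+\rho)$. The essential boundary is $\partial^M\Omega=\mathbb{R}\setminus(\Omega^0\cup\Omega^1)$, and the $\mu$-perimeter is $P_\mu(\Omega)=\int_{\partial^M\Omega}f\,d\mathcal{H}^0=\sum_{x\in\partial^M\Omega}f(x)\in[0,+\infty]$ ($\mathcal{H}^0$ is counting measure). Function $J_\mu$: $F$ is the cumulative distribution function of $\mu$, an increasing bijection from $(a_f,b_f)$ to $(0,1)$ with inverse $F^{-1}$; $J_\mu(r)=f(F^{-1}(r))$ for $r\in(0,1)$ and $J_\mu(0)=J_\mu(1)=0$.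 Isoperimetric deficit: $\delta_\mu(\Omega)=P_\mu(\Omega)-J_\mu(\mu(\Omega))$. Asymmetry: $\lambda_\mu(\Omega)=\min\{\mu(\Omega\,\Delta\,(-\infty,\sigma_-)),\ \mu(\Omega\,\Delta\,(\sigma_+,+\infty))\}$, where $\sigma_-=F^{-1}(\mu(\Omega))$, $\sigma_+=F^{-1}(1-\mu(\Omega))$ and $\Delta$ is symmetric difference, with the convention $F^{-1}(0)=-\infty$, $F^{-1}(1)=+\infty$. *)

(* Defs.v *)
From HB Require Import structures.
From mathcomp Require Import all_boot all_order all_algebra.
From mathcomp Require Import all_classical all_reals all_analysis.

Set Implicit Arguments.
Unset Strict Implicit.
Unset Printing Implicit Defensive.

Import Order.TTheory GRing.Theory Num.Theory.
Import numFieldNormedType.Exports.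

Local Open Scope classical_set_scope.
Local Open Scope ring_scope.

(* The real line with the sigma-algebra of Lebesgue measurable sets, that is,
   the domain of completed_lebesgue_measure. *)
Definition lebesgueTypeR (R : realType) :=
  caratheodory_type ((@wlength R idfun)^*)%mu.

Local Notation leb := completed_lebesgue_measure.

Section measure_with_density.
Context {R : realType}.
Implicit Types (mu : probability (lebesgueTypeR R) R) (f V : R -> R).
Implicit Types (a b : \bar R) (Omega : set R).

Definition open_itv a b : set R := [set x | (a < x%:E < b)%E].

Definition has_density mu f : Prop :=
  forall A : set (lebesgueTypeR R), measurable A ->
    mu A = (\int[leb]_(x in A) (f x)%:E)%E.

Definition log_concave_on (D : set R) f : Prop :=
  exists V, convex_function (E := R^o) D V /\
    forall x, D x -> f x = expR (- V x).

Definition density_points (d : R) Omega : set R :=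
  [set x | (fine (leb (Omega `&` ball x rho)) / fine (leb (ball x rho)))
             @[rho --> 0^'+] --> d].

Definition ess_boundary Omega : set R :=
  ~` (density_points 0 Omega `|` density_points 1 Omega).

Definition perimeter f Omega : \bar R :=
  (\esum_(x in ess_boundary Omega) (f x)%:E)%E.

Definition cumul mu (x : R) : R := fine (mu `]-oo, x]%classic).

Definition cumul_inv mu a b : R -> R :=
  'pinv_(fun=> 0) (open_itv a b) (cumul mu).

Definition cumul_inv_ext mu a b (r : R) : \bar R :=
  if r == 0 then -oo%E else if r == 1 then +oo%E else (cumul_inv mu a b r)%:E.

(* The value 0 is used at every r outside ]0, 1[, not only at 0 and 1. *)
Definition J mu f a b (r : R) : R :=
  if 0 < r < 1 then f (cumul_inv mu a b r) else 0.

Definition deficit mu f a b Omega : \bar R :=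
  (perimeter f Omega - (J mu f a b (fine (mu Omega)))%:E)%E.

Definition asymmetry mu a b Omega : \bar R :=
  let m := fine (mu Omega) in
  let sigma_m := cumul_inv_ext mu a b m in
  let sigma_p := cumul_inv_ext mu a b (1 - m) in
  Order.min (mu (Omega `+` [set x | (x%:E < sigma_m)%E]))
            (mu (Omega `+` [set x | (sigma_p < x%:E)%E])).

End measure_with_density.

(* Main.v *)
Require Import Defs.
From HB Require Import structures.
From mathcomp Require Import all_boot all_order all_algebra.
From mathcomp Require Import finmap.
From mathcomp Require Import all_classical all_reals all_analysis.
From mathcomp Require Import ring lra.

Set Implicit Arguments.
Unset Strict Implicit.
Unset Printing Implicit Defensive.

Import Order.TTheory GRing.Theory Num.Theory.
Import numFieldNormedType.Exports.

Local Open Scope classical_set_scope.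
Local Open Scope ring_scope.

(** Write F for the distribution function and J for the profile, so that
    J(F x) = f x. The proof gives a lower bound of the deficit in terms of
    masses that control the asymmetry.

    The profile. Log-concavity makes J concave: a subgradient c of the convex
    function V at y says that f(t) exp(c t) is nondecreasing before y and
    nonincreasing after y, hence f(x) <= f(y) - c (F x - F y) for every x,
    which is a supporting line of J at F y ([density_support], [J_support]).
    Symmetry gives J(1 - r) = J(r), so J is nondecreasing on [0, 1/2]. A
    concave function vanishing at 0 is subadditive, and the strict decrease of
    J(t)/t near 0 means that its supporting lines at points away from 0 meet
    the vertical axis at a height bounded below by a positive constant; this
    makes the subadditivity uniformly strict ([strict_subadditivity]): if p
    and q in [0, 1/2] stay away from 0, then J(p) + J(q) - J(p + q) stays away
    from 0. This excludes the two-sided exponential law, whose half-lines may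
    be split between the two tails at no cost.

    The sets. On an interval without essential boundary points a measurable
    set is null or of full measure ([ess_boundary_free_null_or_full]), and a
    set of finite perimeter has finitely many essential boundary points in any
    compact part of the support, as f is bounded below there. So
    there is a first boundary point on each side of the origin, or none on that
    side, and between the two the set is null or full; passing to the complement, which changes neither deficit
    nor asymmetry, one may assume that it is null. Let p and q be the masses
    of the set on the left and on the right of 0, let H be the half-line that
    starts at the first boundary point x on the right, and let s be the mass
    of H outside the set. Then f(x) = J(mu H) >= J(q), and the next boundary
    point x', where the set stops filling H, satisfies f(x') >= J(s)
    ([half_line_side]). The same holds on the left, with a mass t, hence
    deficit >= J(p) + J(q) + J(s) + J(t) - J(p + q).

    Conclusion. If the deficit is small then s and t are small, and p or q is
    small. The set differs from H by mass at most p + s, and from the left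
    half-line by at most q + t. Since nested half-lines are compared by their
    masses alone, the asymmetry is at most twice the distance of the set to
    any half-line ([asymmetry_le_half_line]), and it is small. *)

(** * Increment bounds and slopes of convex functions *)

(** Cutting [x, y] into N equal steps, the lower bounds of the increments of
    phi telescope to - (y - x)/N (g y - g x), which vanishes as N grows. This
    replaces integration: g is monotone in one use and linear in the other. *)
Lemma le_of_increment_bound (R : realType) (phi g : R -> R) (x y : R) :
  x <= y ->
  (forall s t, x <= s -> s <= t -> t <= y ->
     - ((t - s) * (g t - g s)) <= phi t - phi s) ->
  phi x <= phi y.
Proof.
move=> xy H; have [->//|/eqP xny] := eqVneq x y.
have {xny}xy : x < y by rewrite lt_neqAle xy andbT; apply/eqP.
have d0 : 0 < y - x by rewrite subr_gt0.
have bound (N : nat) : (0 < N)%N ->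
    - ((y - x) / N%:R * (g y - g x)) <= phi y - phi x.
  move=> N0; have N0' : 0 < N%:R :> R by rewrite ltr0n.
  set h := (y - x) / N%:R; have h0 : 0 < h by rewrite divr_gt0.
  have hN : x + N%:R * h = y by rewrite /h; field; rewrite gt_eqF.
  have step n : (n <= N)%N ->
     - (h * (g (x + n%:R * h) - g x)) <= phi (x + n%:R * h) - phi x.
    elim: n => [_|n IH nN]; first by rewrite mul0r addr0 !subrr mulr0 oppr0.
    have n0 : 0 <= n%:R :> R by rewrite ler0n.
    have := IH (ltnW nN).
    have := H (x + n%:R * h) (x + n.+1%:R * h).
    have -> : x + n.+1%:R * h - (x + n%:R * h) = h by rewrite -natr1; ring.
    have c1 : x <= x + n%:R * h by rewrite lerDl mulr_ge0 // ltW.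
    have c2 : x + n%:R * h <= x + n.+1%:R * h.
      by rewrite lerD2l ler_pM2r// ler_nat.
    have c3 : x + n.+1%:R * h <= y.
      by rewrite -hN lerD2l ler_pM2r// ler_nat.
    move=> /(_ c1 c2 c3); lra.
  by have := step N (leqnn _); rewrite hN.
rewrite -subr_ge0 leNgt; apply/negP => neg.
set C := `|(y - x) * (g y - g x)|.
have [n Hn] : exists n : nat, C / (phi x - phi y) < n%:R.
  exists (Num.truncn (C / (phi x - phi y))).+1; apply: Num.Theory.truncnS_gt.
have p0 : 0 < phi x - phi y by lra.
have C0 : 0 <= C by rewrite normr_ge0.
have n0 : 0 < n%:R :> R by apply: le_lt_trans Hn; rewrite divr_ge0// ltW.
have := bound n; rewrite -(ltr0n R) n0 => /(_ isT).
rewrite ltr_pdivrMr// in Hn.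
have -> : (y - x) / n%:R * (g y - g x) = (y - x) * (g y - g x) / n%:R by ring.
rewrite -mulNr ler_pdivrMr// => B.
have := ler_norm ((y - x) * (g y - g x)); rewrite -/C => Cle.
have : (phi y - phi x) * n%:R = - (n%:R * (phi x - phi y)) by ring.
lra.
Qed.

Section convex_on_open_interval.
Context (R : realType) (a b : \bar R) (V : R -> R).
Hypothesis convV : convex_function (E := R^o) (open_itv a b) V.
Local Notation D := (open_itv a b).

Lemma open_itv_between x y z : D x -> D z -> x <= y -> y <= z -> D y.
Proof.
rewrite /open_itv/= => /andP[ax _] /andP[_ zb] xy yz; apply/andP; split.
  by apply: lt_le_trans ax _; rewrite lee_fin.
by apply: le_lt_trans _ zb; rewrite lee_fin.
Qed.

Lemma convex_chord x y z : D x -> D z -> x <= y -> y <= z ->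
  (z - x) * V y <= (z - y) * V x + (y - x) * V z.
Proof.
move=> Dx Dz xy yz; have [xz|xz] := eqVneq x z.
  by have -> : y = x by [lra]; rewrite xz; lra.
have zx : 0 < z - x by rewrite subr_gt0 lt_neqAle xz (le_trans xy yz).
have t01 : 0 <= (z - y) / (z - x) <= 1.
  by rewrite divr_ge0 ?ler_pdivrMr//; lra.
pose t : {i01 R} := Itv01 (proj1 (andP t01)) (proj2 (andP t01)).
have := convV t (mem_set Dx) (mem_set Dz).
have -> : conv t (x : convex_lmodType R^o) z = y :> R.
  rewrite [LHS](convRE (x : R^o) z t)/= /unstable.onem; field; lra.
rewrite convRE /= /unstable.onem => H.
have -> : (z - y) * V x + (y - x) * V z =
   (z - x) * ((z - y) / (z - x) * V x + (1 - (z - y) / (z - x)) * V z).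
  by field; lra.
by rewrite ler_pM2l.
Qed.

Lemma convex_slopes s t s' t' : D s -> D t' ->
  s < t -> t <= s' -> s' < t' ->
  (V t - V s) / (t - s) <= (V t' - V s') / (t' - s').
Proof.
move=> Ds Dt' st ts' st'.
have Dt : D t by apply: (open_itv_between Ds Dt'); lra.
have Ds' : D s' by apply: (open_itv_between Ds Dt'); lra.
have three x y z : D x -> D z -> x < y -> y < z ->
   (V y - V x) / (y - x) <= (V z - V y) / (z - y).
  move=> Dx Dz xy yz.
  have := convex_chord Dx Dz (ltW xy) (ltW yz) => H.
  rewrite ler_pdivrMr ?subr_gt0// mulrAC ler_pdivlMr ?subr_gt0//.
  nra.
have [E|ne] := eqVneq t s'; first by subst s'; exact: three.
have ts : t < s' by rewrite lt_neqAle ne.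
by apply: le_trans (three _ _ _ Ds Ds' st ts) (three _ _ _ Dt Dt' ts st').
Qed.

Lemma open_itv_neighbours y : D y -> exists s t, [/\ D s, D t, s < y & y < t].
Proof.
rewrite /open_itv/= => /andP[ay yb].
have [s [as_ sy]] : exists s : R, (a < s%:E)%E /\ s < y.
  case: a ay => [r| |] // ay.
    by exists ((r + y) / 2); rewrite !lte_fin in ay *; lra.
  by exists (y - 1); rewrite ltNyr; split => //; lra.
have [t [tb yt]] : exists t : R, (t%:E < b)%E /\ y < t.
  case: b yb => [r| |] // yb.
    by exists ((r + y) / 2); rewrite !lte_fin in yb *; lra.
  by exists (y + 1); rewrite ltry; split => //; lra.
exists s, t; split => //; rewrite ?as_ ?tb ?andbT/=.
  by apply: lt_trans yb; rewrite lte_fin.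
by apply: lt_trans ay _; rewrite lte_fin.
Qed.

(** The supremum of the slopes on the left of y separates them from the slopes
    on its right. *)
Lemma convex_subgradient y : D y -> exists c,
  (forall s t, D s -> s <= t -> t <= y -> V t - V s <= c * (t - s)) /\
  (forall s t, D t -> y <= s -> s <= t -> c * (t - s) <= V t - V s).
Proof.
move=> Dy; have [s0 [t0 [Ds0 Dt0 s0y yt0]]] := open_itv_neighbours Dy.
pose S := [set q | exists s t, [/\ D s, s < t, t <= y & q = (V t - V s) / (t - s)]].
have S0 : S !=set0 by exists ((V y - V s0) / (y - s0)), s0, y.
have ubS s t : D t -> y <= s -> s < t -> ubound S ((V t - V s) / (t - s)).
  move=> Dt ys st q [s' [t' [Ds' s't' t'y ->]]].
  by apply: convex_slopes => //; exact: le_trans ys.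
exists (sup S); split => s t.
  move=> Ds st ty; have [->|ne] := eqVneq s t; first by rewrite !subrr mulr0.
  have {ne}st : s < t by rewrite lt_neqAle ne.
  rewrite -ler_pdivrMr ?subr_gt0//; apply: ub_le_sup.
    by exists ((V t0 - V y) / (t0 - y)); exact: ubS.
  by exists s, t.
move=> Dt ys st; have [->|ne] := eqVneq s t; first by rewrite !subrr mulr0.
have {ne}st : s < t by rewrite lt_neqAle ne.
rewrite -ler_pdivlMr ?subr_gt0//; apply: ge_sup => //; exact: ubS.
Qed.

End convex_on_open_interval.

(** * Concave profiles *)

Section concave_profile.
Context (R : realType) (I : R -> R).
Hypothesis I0 : I 0 = 0.
Hypothesis I_gt0 : forall r, 0 < r < 1 -> 0 < I r.
Hypothesis I_support : forall r, 0 < r < 1 ->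
  exists k, forall s, 0 <= s <= 1 -> I s <= I r + k * (s - r).
Hypothesis I_nondecreasing :
  forall r t, 0 <= r -> r <= t -> t <= 1 / 2 -> I r <= I t.

Lemma profile_small_arg (eta : R) : 0 < eta -> exists2 delta, 0 < delta &
  forall u, 0 <= u <= 1 / 2 -> I u < delta -> u < eta.
Proof.
move=> eta0; have [big|small] := ltP (1 / 2) eta.
  by exists 1 => // u; lra.
exists (I eta); first by apply: I_gt0; lra.
move=> u u01; apply: contraTT; rewrite -!leNgt => h.
by apply: I_nondecreasing; lra.
Qed.

(** The left side is the height at which the supporting line at p meets the
    vertical axis. Slopes of supporting lines decrease, so beyond q the profile
    grows by at most k p when its argument grows by p. *)
Lemma subadditivity_gap (p q k : R) : 0 < p -> p <= q -> q <= 1 / 2 ->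
  (forall s, 0 <= s <= 1 -> I s <= I p + k * (s - p)) ->
  I p - k * p <= I p + I q - I (p + q).
Proof.
move=> p0 pq q1 Hk; have [E|ne] := eqVneq p q.
  by subst q; have := Hk (p + p) ltac:(lra); lra.
have {ne}pq' : p < q by rewrite lt_neqAle ne.
have [kq Hq] := I_support (r := q) ltac:(lra).
have h1 := Hq (p + q) ltac:(lra).
have h2 := Hq p ltac:(lra).
have h3 := Hk q ltac:(lra).
have qp0 : 0 < q - p by lra.
have kk : kq <= k by rewrite -(ler_pM2r qp0); lra.
have : p * kq <= p * k by rewrite ler_pM2l.
lra.
Qed.

Lemma subadditivity (p q : R) : 0 <= p <= 1 / 2 -> 0 <= q <= 1 / 2 ->
  I (p + q) <= I p + I q.
Proof.
wlog pq : p q / p <= q.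
  move=> H p01 q01; have [pq|/ltW qp] := leP p q; first exact: H.
  by rewrite (addrC p q) (addrC (I p)); exact: H.
move=> p01 q01; have [->|p0] := eqVneq p 0; first by rewrite I0 !add0r.
have {}p0 : 0 < p by rewrite lt_neqAle eq_sym p0; lra.
have [k Hk] := I_support (r := p) ltac:(lra).
have := subadditivity_gap p0 pq ltac:(lra) Hk.
have := Hk 0 ltac:(lra); rewrite I0; lra.
Qed.

(** Only the strict decrease of I(t)/t near 0 is assumed: at a fixed small e it
    gives I(e) > I(2e)/2, and concavity carries this gap to all p >= 2e, since
    the height at which the supporting line at p meets the axis is at least
    I(e) - I(2e)/2. *)
Lemma strict_subadditivity (eps : R) : 0 < eps ->
  (forall s t, 0 < s -> s < t -> t < eps -> I t / t < I s / s) ->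
  forall eta, 0 < eta -> exists2 delta, 0 < delta &
    forall p q, 0 <= p <= 1 / 2 -> 0 <= q <= 1 / 2 ->
      I p + I q - I (p + q) < delta -> p < eta \/ q < eta.
Proof.
move=> eps0 decr eta eta0.
pose e := Num.min (1 / 8) (Num.min (eta / 2) (eps / 3)).
have e0 : 0 < e by rewrite !lt_min; apply/and3P; split; lra.
have [e1 [e2 e3]] : e <= 1 / 8 /\ e <= eta / 2 /\ e <= eps / 3.
  by rewrite /e !ge_min !lexx ?orbT.
have A0 : 0 < I e - I (2 * e) / 2.
  have := decr e (2 * e) e0 ltac:(lra) ltac:(lra).
  rewrite ltr_pdivrMr; last lra.
  have -> : I e / e * (2 * e) = 2 * I e by field; lra.
  lra.
exists (I e - I (2 * e) / 2) => // p q.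
wlog pq : p q / p <= q.
  move=> H p01 q01; have [pq|/ltW qp] := leP p q; first exact: H.
  by rewrite (addrC p q) (addrC (I p)) => h; apply/or_comm; exact: H.
move=> p01 q01 small; left; rewrite ltNge; apply/negP => petap.
have p_2e : 2 * e <= p by lra.
have [k Hk] := I_support (r := p) ltac:(lra).
have [k2 Hk2] := I_support (r := 2 * e) ltac:(lra).
set c := I p - k * p.
have c0 : 0 <= c by have := Hk 0 ltac:(lra); rewrite I0 /c; lra.
(* The ratio I(t)/t is nonincreasing, by the supporting line at 2e. *)
have ratio : I p * (2 * e) <= I (2 * e) * p.
  have := Hk2 0 ltac:(lra); rewrite I0 => h0.
  have := Hk2 p ltac:(lra) => h1.
  have : (2 * e) * I p <= (2 * e) * (I (2 * e) + k2 * (p - 2 * e)).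
    by rewrite ler_pM2l//; lra.
  have : (p - 2 * e) * (k2 * (2 * e)) <= (p - 2 * e) * I (2 * e).
    by rewrite ler_wpM2l; lra.
  lra.
(* The line of height c at 0 through the graph at p lies above the graph at e. *)
have cA : I e - I (2 * e) / 2 <= c.
  have := Hk e ltac:(lra) => h.
  have p0 : 0 < p by lra.
  rewrite -(ler_pM2l p0).
  have : p * I e <= p * (I p + k * (e - p)) by rewrite ler_pM2l.
  have ec : 0 <= e * c by rewrite mulr_ge0// ltW.
  move: ec; rewrite /c; lra.
have := subadditivity_gap (p := p) (q := q) ltac:(lra) pq ltac:(lra) Hk.
rewrite -/c; lra.
Qed.

End concave_profile.

(** * Lebesgue measure and measures with a density *)

Section lebesgue_measurable_sets.
Context (R : realType).
Local Notation leb := (@completed_lebesgue_measure R).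
Local Notation mble A := (measurable (A : set (lebesgueTypeR R))).

Lemma borel_lebesgue_measurable (A : set R) :
  measurable (A : set (measurableTypeR R)) -> mble A.
Proof. exact: sub_caratheodory. Qed.

Lemma itv_lebesgue_measurable (i : interval R) : mble [set` i].
Proof. by apply: borel_lebesgue_measurable; exact: measurable_itv. Qed.

(** On Borel sets the completed measure is by definition the Lebesgue measure:
    both are restrictions of the same outer measure. *)
Lemma leb_itv (x y : R) (c d : bool) : x <= y ->
  leb [set` Interval (BSide c x) (BSide d y)] = (y - x)%:E.
Proof.
move=> xy; transitivity
  (lebesgue_measure ([set` Interval (BSide c x) (BSide d y)] : set R)).
  by [].
rewrite lebesgue_measure_itv/= lte_fin; case: ltP => [//|yx].
by have -> : x = y; [lra | rewrite subrr].
Qed.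

End lebesgue_measurable_sets.

Section density_bounds.
Context (R : realType) (mu : probability (lebesgueTypeR R) R) (f : R -> R).
Hypothesis f_density : has_density mu f.
Hypothesis f_ge0 : forall x, 0 <= f x.
Local Notation leb := (@completed_lebesgue_measure R).
Local Notation mble A := (measurable (A : set (lebesgueTypeR R))).

(** The integral of a nonnegative function is a supremum over the simple
    functions below it, so it is monotone without measurability; this avoids
    proving that the density is measurable. *)
Lemma le_integral_nonmeasurable (A : set R) (g h : R -> R) :
  (forall x, A x -> 0 <= g x) -> (forall x, A x -> g x <= h x) ->
  (\int[leb]_(x in A) (g x)%:E <= \int[leb]_(x in A) (h x)%:E)%E.
Proof.
move=> g0 gh; rewrite !ge0_integralE; last 2 first.
- by move=> x Ax; rewrite lee_fin (le_trans (g0 _ Ax)) ?gh.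
- by move=> x Ax; rewrite lee_fin g0.
apply: le_ereal_sup => _ [k kg <-]; exists k => // x.
apply: le_trans (kg x) _; rewrite /patch; case: ifPn => //.
by rewrite inE => Ax; rewrite lee_fin gh.
Qed.

Lemma density_le (A : set R) (M : R) : mble A -> (forall x, A x -> f x <= M) ->
  (mu A <= M%:E * leb A)%E.
Proof.
move=> mA fM; rewrite f_density// -integral_cst//.
exact: le_integral_nonmeasurable.
Qed.

Lemma density_ge (A : set R) (c : R) : mble A -> 0 <= c ->
  (forall x, A x -> c <= f x) -> (c%:E * leb A <= mu A)%E.
Proof.
move=> mA c0 cf; rewrite f_density// -integral_cst//.
exact: le_integral_nonmeasurable.
Qed.

Lemma fin_mu (A : set R) : mble A -> mu A = (fine (mu A))%:E.
Proof. by move=> mA; rewrite fineK// fin_num_measure. Qed.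

Lemma cumulB (x y : R) : x <= y -> cumul mu y - cumul mu x = fine (mu `]x, y]%classic).
Proof.
move=> xy; rewrite /cumul.
have -> : `]-oo, y]%classic = `]-oo, x]%classic `|` `]x, y]%classic :> set R.
  by rewrite -itv_bndbnd_setU.
rewrite measureU//=; first last.
- apply/seteqP; split => z //=.
  by rewrite !in_itv/= => -[/le_lt_trans H /andP[/H]]; rewrite ltxx.
- exact: itv_lebesgue_measurable.
- exact: itv_lebesgue_measurable.
rewrite fineD ?fin_num_measure//; try exact: itv_lebesgue_measurable.
by rewrite addrAC subrr add0r.
Qed.

Lemma cumulB_le (x y M : R) : x <= y -> (forall u, x < u -> u <= y -> f u <= M) ->
  cumul mu y - cumul mu x <= M * (y - x).
Proof.
move=> xy fM; rewrite cumulB//.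
have mI := itv_lebesgue_measurable `]x, y].
rewrite -lee_fin -fin_mu// EFinM -(leb_itv false false xy).
by apply: density_le => // u /=; rewrite in_itv/= => /andP[/fM].
Qed.

Lemma cumulB_ge (x y c : R) : x <= y -> 0 <= c ->
  (forall u, x < u -> u <= y -> c <= f u) ->
  c * (y - x) <= cumul mu y - cumul mu x.
Proof.
move=> xy c0 cf; rewrite cumulB//.
have mI := itv_lebesgue_measurable `]x, y].
rewrite -lee_fin -fin_mu// EFinM -(leb_itv false false xy).
by apply: density_ge => // u /=; rewrite in_itv/= => /andP[/cf].
Qed.

Lemma cumul_ge0 x : 0 <= cumul mu x.
Proof. by rewrite fine_ge0. Qed.

Lemma cumul_le1 x : cumul mu x <= 1.
Proof.
rewrite /cumul -lee_fin -fin_mu; last exact: itv_lebesgue_measurable.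
by rewrite probability_le1//; exact: itv_lebesgue_measurable.
Qed.

Lemma cumul_nondecreasing x y : x <= y -> cumul mu x <= cumul mu y.
Proof. by move=> xy; rewrite -subr_ge0 cumulB// fine_ge0. Qed.

Lemma cumul_tails (e : R) : 0 < e ->
  exists x : R, [/\ 0 <= x, cumul mu (- x) < e & 1 - e < cumul mu x].
Proof.
move=> e0; pose A (n : nat) : set R := `]- n%:R, n%:R]%classic.
have mA n : mble (A n) by exact: itv_lebesgue_measurable.
have : mu (A n) @[n --> \oo] --> mu (\bigcup_n A n).
  apply: nondecreasing_cvg_mu => //; first exact: bigcup_measurable.
  move=> n m nm; apply/subsetPset => x; rewrite /A/= !in_itv/= => /andP[h1 h2].
  have nm' : n%:R <= m%:R :> R by rewrite ler_nat.
  apply/andP; lra.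
have -> : \bigcup_n A n = setT.
  apply/seteqP; split => // x _; exists (Num.truncn `|x|).+1 => //=.
  have := Num.Theory.truncnS_gt `|x|; rewrite ltr_norml => /andP[h1 /ltW h2].
  by rewrite /A/= in_itv/= h1 h2.
rewrite probability_setT => /fine_cvgP[_ /cvgrPdist_lt /(_ _ e0)] [N _ /(_ N (leqnn N))].
have N0 : 0 <= N%:R :> R by rewrite ler0n.
rewrite /= /A -cumulB; last lra.
move=> /ltr_normlP[_]; rewrite opprB => H.
exists N%:R; have := cumul_le1 N%:R; have := cumul_ge0 (- N%:R).
move: H; rewrite /=; split => //; lra.
Qed.

End density_bounds.

(** * Intervals without essential boundary points *)

Section ess_boundary_free_intervals.
Context (R : realType).
Local Notation leb := (@completed_lebesgue_measure R).
Local Notation mble A := (measurable (A : set (lebesgueTypeR R))).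
Implicit Types (Omega : set R) (x y : R).

Lemma leb_ball x (rho : R) : 0 < rho -> leb (ball x rho) = (2 * rho)%:E.
Proof. by move=> r0; rewrite ball_itv leb_itv; [congr _%:E; ring|lra]. Qed.

Lemma ball_lebesgue_measurable x (rho : R) : mble (ball x rho).
Proof. by rewrite ball_itv; exact: itv_lebesgue_measurable. Qed.

Lemma fin_leb_bounded Omega (c d : R) (A : set R) : mble Omega -> mble A ->
  A `<=` `[c, d] -> leb (Omega `&` A) \is a fin_num.
Proof.
move=> mO mA Acd; have [cd|dc] := leP c d; last first.
  rewrite (_ : _ `&` _ = set0) ?measure0//; apply/seteqP; split => // z [_ /Acd].
  by rewrite /= in_itv/= => /andP[h1 h2]; lra.
rewrite ge0_fin_numE//; apply: (@le_lt_trans _ _ (leb `[c, d]%classic)).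
  apply: le_measure; rewrite ?inE; last by move=> z [_ /Acd].
    exact: measurableI.
  exact: itv_lebesgue_measurable.
by rewrite leb_itv// ltry.
Qed.

Lemma density0_small Omega x (e : R) : mble Omega -> density_points 0 Omega x ->
  0 < e -> exists2 r : R, 0 < r & forall rho, 0 < rho -> rho < r ->
    (leb (Omega `&` ball x rho) <= (e * rho)%:E)%E.
Proof.
move=> mO /cvgrPdist_lt H e0; have e2 : 0 < e / 2 by lra.
have [r /= r0 Hr] := H _ e2.
exists r => // rho rho0 rhor.
have := Hr rho; rewrite /ball_ /= ?sub0r normrN gtr0_norm// => /(_ rhor rho0).
rewrite leb_ball//= normrN ger0_norm ?divr_ge0 ?fine_ge0//; last lra.
have finO : leb (Omega `&` ball x rho) \is a fin_num.
  apply: (@fin_leb_bounded _ (x - rho) (x + rho)) => //.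
    exact: ball_lebesgue_measurable.
  by rewrite ball_itv => z /=; rewrite !in_itv/= => /andP[/ltW -> /ltW ->].
rewrite -[leb _](fineK finO) lee_fin ltr_pdivrMr; last lra.
by move=> /ltW; have -> : e / 2 * (2 * rho) = e * rho by field.
Qed.

Lemma density0_of_null Omega x (r : R) : 0 < r -> mble Omega ->
  leb (Omega `&` ball x r) = 0%E -> density_points 0 Omega x.
Proof.
move=> r0 mO O0; apply/cvgrPdist_lt => e e0.
exists r => //= rho; rewrite /ball_/= sub0r normrN => rhor rho0.
rewrite gtr0_norm// in rhor.
have -> : leb (Omega `&` ball x rho) = 0%E.
  apply/eqP; rewrite eq_le measure_ge0 andbT -O0; apply: le_measure; rewrite ?inE.
  - by apply: measurableI => //; exact: ball_lebesgue_measurable.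
  - by apply: measurableI => //; exact: ball_lebesgue_measurable.
  - by apply: setIS; apply: le_ball; exact: ltW.
by rewrite /= mul0r subrr normr0.
Qed.

Lemma density_ratio_setC Omega x (rho : R) : mble Omega -> 0 < rho ->
  fine (leb (~` Omega `&` ball x rho)) / fine (leb (ball x rho)) =
  1 - fine (leb (Omega `&` ball x rho)) / fine (leb (ball x rho)).
Proof.
move=> mO r0; have mB := ball_lebesgue_measurable x rho.
have sub : ball x rho `<=` `[x - rho, x + rho]%classic.
  by rewrite ball_itv => z /=; rewrite !in_itv/= => /andP[/ltW -> /ltW ->].
have fin1 := fin_leb_bounded mO mB sub.
have fin2 := fin_leb_bounded (measurableC mO) mB sub.
have : leb (ball x rho) = (leb (Omega `&` ball x rho) + leb (~` Omega `&` ball x rho))%E.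
  rewrite -measureU//=; first by rewrite -setIUl setUCr setTI.
  - exact: measurableI.
  - by apply: measurableI => //; exact: measurableC.
  - by rewrite setIACA setICr set0I.
rewrite leb_ball// -[leb (Omega `&` _)](fineK fin1) -[leb (~` Omega `&` _)](fineK fin2).
by move=> [E]; rewrite /= E in r0 *; field; lra.
Qed.

Lemma density1_setC Omega : mble Omega ->
  density_points 1 Omega = density_points 0 (~` Omega).
Proof.
move=> mO; apply/seteqP; split=> x /cvgrPdist_lt H; apply/cvgrPdist_lt => e e0;
  have [r /= r0 Hr] := H _ e0;
  exists r => // rho rr rho0; have := Hr rho rr rho0;
  rewrite density_ratio_setC//; first by rewrite sub0r normrN.
by rewrite sub0r normrN.
Qed.

Lemma density0_setC Omega : mble Omega ->
  density_points 0 Omega = density_points 1 (~` Omega).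
Proof. by move=> mO; rewrite density1_setC ?setCK//; exact: measurableC. Qed.

Lemma ess_boundary_setC Omega : mble Omega ->
  ess_boundary (~` Omega) = ess_boundary Omega.
Proof.
by move=> mO; rewrite /ess_boundary -density0_setC// -density1_setC// setUC.
Qed.

Lemma fin_leb_itv Omega (u v : R) : mble Omega ->
  leb (Omega `&` `]u, v]%classic) \is a fin_num.
Proof.
move=> mO; apply: (@fin_leb_bounded _ u v) => //; first exact: itv_lebesgue_measurable.
by move=> z /=; rewrite !in_itv/= => /andP[/ltW -> ->].
Qed.

Let N Omega (c t : R) := fine (leb (Omega `&` `]c, t]%classic)).

Lemma partial_lengthB Omega (c s t : R) : mble Omega -> c <= s -> s <= t ->
  N Omega c t - N Omega c s = fine (leb (Omega `&` `]s, t]%classic)).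
Proof.
move=> mO cs st; rewrite /N.
have fin u v := fin_leb_itv u v mO.
have mI u v : mble (Omega `&` `]u, v]%classic).
  by apply: measurableI => //; exact: itv_lebesgue_measurable.
have -> : `]c, t]%classic = `]c, s]%classic `|` `]s, t]%classic :> set R.
  by rewrite -itv_bndbnd_setU// ?bnd_simp.
rewrite setIUr measureU//=; first by rewrite fineD// addrAC subrr add0r.
apply/seteqP; split => z //=.
by rewrite !in_itv/= => -[[_ /andP[_ zs]] [_ /andP[sz _]]]; lra.
Qed.

Lemma partial_length_lipschitz Omega (c s t : R) : mble Omega ->
  `|N Omega c s - N Omega c t| <= `|s - t|.
Proof.
move=> mO; wlog st : s t / s <= t.
  move=> H; have [|/ltW ts] := leP s t; first exact: H.
  by rewrite distrC [leRHS]distrC; exact: H.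
have fin u v := fin_leb_itv u v mO.
have mI u v : mble (Omega `&` `]u, v]%classic).
  by apply: measurableI => //; exact: itv_lebesgue_measurable.
rewrite distrC [leRHS]distrC [leRHS]ger0_norm ?subr_ge0//.
have [cs|sc] := leP c s.
  rewrite partial_lengthB// ger0_norm ?fine_ge0// -lee_fin fineK//.
  rewrite -(leb_itv false false st).
  by apply: le_measure; rewrite ?inE//; exact: itv_lebesgue_measurable.
have -> : N Omega c s = 0.
  rewrite /N (_ : _ `&` _ = set0) ?measure0//; apply/seteqP; split => // z [_ /=].
  by rewrite in_itv/= => /andP[]; lra.
rewrite subr0 ger0_norm ?fine_ge0// /N -lee_fin fineK// -(leb_itv false false st).
apply: le_measure; rewrite ?inE//; first exact: itv_lebesgue_measurable.
by move=> z [_]; rewrite /= !in_itv/= => /andP[h1 ->]; rewrite andbT; lra.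
Qed.

Lemma density0_one_sided Omega x (e : R) : mble Omega ->
  density_points 0 Omega x -> 0 < e ->
  exists2 r : R, 0 < r & forall h, 0 < h -> h < r ->
    fine (leb (Omega `&` `]x, x + h]%classic)) <= e * h /\
    fine (leb (Omega `&` `]x - h, x]%classic)) <= e * h.
Proof.
move=> mO Ox e0; have e2 : 0 < e / 2 by lra.
have [r r0 Hr] := density0_small mO Ox e2; exists (r / 2); first lra.
move=> h h0 hr; have := Hr (2 * h) ltac:(lra) ltac:(lra).
have -> : e / 2 * (2 * h) = e * h by field.
move=> bd; have mB := ball_lebesgue_measurable x (2 * h).
have sub (u v : R) : x - 2 * h < u -> v < x + 2 * h -> u <= v ->
    fine (leb (Omega `&` `]u, v]%classic)) <= e * h.
  move=> hu hv uv; rewrite -lee_fin fineK; last exact: fin_leb_itv.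
  apply: le_trans bd; apply: le_measure; rewrite ?inE.
  - by apply: measurableI => //; exact: itv_lebesgue_measurable.
  - exact: measurableI.
  - apply: setIS; rewrite ball_itv => z /=; rewrite !in_itv/= => /andP[h1 h2].
    by apply/andP; split; lra.
by split; apply: sub; lra.
Qed.

Lemma leb_itv_setC Omega (s t : R) : mble Omega -> s <= t ->
  fine (leb (Omega `&` `]s, t]%classic)) =
  t - s - fine (leb (~` Omega `&` `]s, t]%classic)).
Proof.
move=> mO st; have mI := itv_lebesgue_measurable `]s, t].
have : leb `]s, t]%classic =
    (leb (Omega `&` `]s, t]%classic) + leb (~` Omega `&` `]s, t]%classic))%E.
  rewrite -measureU//=; first by rewrite -setIUl setUCr setTI.
  - exact: measurableI.
  - by apply: measurableI => //; exact: measurableC.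
  - by rewrite setIACA setICr set0I.
rewrite leb_itv// -[leb (Omega `&` _)](fineK (fin_leb_itv _ _ mO)).
rewrite -[leb (~` Omega `&` _)](fineK (fin_leb_itv _ _ (measurableC mO))).
by rewrite -EFinD => -[->]; rewrite /= addrK.
Qed.

(** A minimum point of N(t) - kappa t on [c, d], where N(t) is the length of
    the part of Omega in ]c, t]. At a point of density 0, N has derivative 0 and
    the tilted function decreases to the right; at a point of density 1, N has
    derivative 1 and the tilted function increases from the left. This is the
    argument for the intermediate value property of derivatives. *)
Lemma partial_length_tilted_min Omega (c d kappa : R) : mble Omega -> c <= d ->
  0 < kappa < 1 ->
  exists t0, [/\ c <= t0, t0 <= d,
    t0 < d -> ~ density_points 0 Omega t0,
    c < t0 -> ~ density_points 0 (~` Omega) t0 &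
    N Omega c t0 <= kappa * (t0 - c)].
Proof.
move=> mO cd /andP[k0 k1]; pose H t := N Omega c t - kappa * t.
have contH : continuous H.
  move=> s; apply: cvgB; last by apply: cvgMr; exact: cvg_id.
  apply/cvgrPdist_lt => e e0; near=> t.
  by apply: le_lt_trans (partial_length_lipschitz c s t mO) _; near: t;
    exact: (nbhsx_ballx s e).
have [t0 + Hmin] := EVT_min cd (continuous_subspaceT contH).
rewrite in_itv/= => /andP[ct0 t0d]; exists t0; split => //.
- move=> t0d' Ot0; have k2 : 0 < kappa / 2 by lra.
  have [r r0 Hr] := density0_one_sided mO Ot0 k2.
  set h := Num.min (r / 2) ((d - t0) / 2).
  have h0 : 0 < h by rewrite lt_min !divr_gt0// subr_gt0.
  have hr : h <= r / 2 by rewrite ge_min lexx.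
  have hd : h <= (d - t0) / 2 by rewrite ge_min lexx orbT.
  have [small _] := Hr h h0 ltac:(lra).
  have := Hmin (t0 + h); rewrite in_itv/= => /(_ ltac:(lra)); rewrite /H.
  have := @partial_lengthB Omega c t0 (t0 + h) mO ct0 ltac:(lra).
  have : 0 < kappa * h by rewrite mulr_gt0.
  lra.
- move=> ct0' Ot0; have k2 : 0 < (1 - kappa) / 2 by lra.
  have [r r0 Hr] := density0_one_sided (measurableC mO) Ot0 k2.
  set h := Num.min (r / 2) ((t0 - c) / 2).
  have h0 : 0 < h by rewrite lt_min !divr_gt0// subr_gt0.
  have hr : h <= r / 2 by rewrite ge_min lexx.
  have hd : h <= (t0 - c) / 2 by rewrite ge_min lexx orbT.
  have [_ small] := Hr h h0 ltac:(lra).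
  have := Hmin (t0 - h); rewrite in_itv/= => /(_ ltac:(lra)); rewrite /H.
  have := @partial_lengthB Omega c (t0 - h) t0 mO ltac:(lra) ltac:(lra).
  have := @leb_itv_setC Omega (t0 - h) t0 mO ltac:(lra).
  have : 0 < (1 - kappa) * h by rewrite mulr_gt0// subr_gt0.
  lra.
have := Hmin c; rewrite in_itv/= lexx cd => /(_ isT); rewrite /H.
have -> : N Omega c c = 0.
  by rewrite /N set_itv_ge ?bnd_simp ?ltxx// setI0 measure0.
lra.
Unshelve. all: by end_near. Qed.

(** When every point has density 0 the minimum of the tilted length is at d,
    for every kappa in ]0, 1[, so the length is at most kappa (d - c). *)
Lemma null_of_density0 Omega (c d : R) : mble Omega -> c <= d ->
  (forall t, c <= t -> t <= d -> density_points 0 Omega t) ->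
  leb (Omega `&` `]c, d]%classic) = 0%E.
Proof.
move=> mO cd O0; rewrite -[LHS](fineK (fin_leb_itv _ _ mO)); congr _%:E.
apply/eqP; rewrite eq_le fine_ge0// andbT; apply/ler_addgt0Pr => e e0.
rewrite add0r; set kappa := Num.min (1/2) (e / (d - c + 1)).
have dc1 : 0 < d - c + 1 by lra.
have k0 : 0 < kappa by rewrite lt_min; apply/andP; split; [lra|exact: divr_gt0].
have k1 : kappa <= 1 / 2 by rewrite ge_min lexx.
have ke : kappa * (d - c + 1) <= e by rewrite -ler_pdivlMr// ge_min lexx orbT.
have [t0 [ct0 t0d h1 _ h3]] :=
  @partial_length_tilted_min Omega c d kappa mO cd ltac:(lra).
have t0E : t0 = d.
  apply/eqP; rewrite eq_le t0d/= leNgt; apply/negP => /h1; apply; exact: O0.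
rewrite t0E in h3; apply: le_trans h3 _; lra.
Qed.

(** With kappa = 1/2 the tilted length would have no minimum point on [c, d]:
    its density 0 excludes c, its density 1 excludes d, and an interior point is
    excluded either way. *)
Lemma no_jump Omega (c d : R) : mble Omega -> c < d ->
  (forall t, c <= t -> t <= d ->
     density_points 0 Omega t \/ density_points 0 (~` Omega) t) ->
  density_points 0 Omega c -> density_points 0 (~` Omega) d -> False.
Proof.
move=> mO cd O01 Oc Od.
have [t0 [ct0 t0d h1 h2 _]] :=
  @partial_length_tilted_min Omega c d (1 / 2) mO (ltW cd) ltac:(lra).
have [E|ne] := eqVneq t0 c; first by apply: h1; rewrite E; [exact: cd|exact: Oc].
have ct : c < t0 by rewrite lt_neqAle eq_sym ne.
have [E|ne'] := eqVneq t0 d; first by apply: (h2 ct); rewrite E; exact: Od.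
have td : t0 < d by rewrite lt_neqAle ne'.
by have [/(h1 td)|/(h2 ct)] := O01 t0 ct0 t0d.
Qed.

Lemma open_itv_measurable (a b : \bar R) : mble (open_itv a b).
Proof.
have half (c : bool) (u : \bar R) :
    mble [set x : R | if c then (u < x%:E)%E else (x%:E < u)%E].
  case: u => [r| |].
  - have -> : [set x : R | if c then (r%:E < x%:E)%E else (x%:E < r%:E)%E] =
        if c then `]r, +oo[%classic else `]-oo, r[%classic.
      by apply/seteqP; case: c; split => x /=; rewrite !in_itv/= ?andbT lte_fin.
    by case: c; exact: itv_lebesgue_measurable.
  - have -> : [set x : R | if c then (+oo < x%:E)%E else (x%:E < +oo)%E] =
        if c then set0 else setT.
      by apply/seteqP; case: c; split => x //=; rewrite ltry.
    by case: c.
  - have -> : [set x : R | if c then (-oo < x%:E)%E else (x%:E < -oo)%E] =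
        if c then setT else set0.
      by apply/seteqP; case: c; split => x //=; rewrite ltNyr.
    by case: c.
have -> : open_itv a b = [set x : R | (a < x%:E)%E] `&` [set x : R | (x%:E < b)%E].
  by apply/seteqP; split => x /= => [/andP[]|[h1 h2]] //; apply/andP.
by apply: measurableI; [exact: (half true)|exact: (half false)].
Qed.

(** The open interval may be unbounded; it is covered by the countably many
    compact intervals with rational ends inside it. *)
Lemma leb_null_open_itv Omega (a b : \bar R) : mble Omega ->
  (forall t, open_itv a b t -> density_points 0 Omega t) ->
  leb (Omega `&` open_itv a b) = 0%E.
Proof.
move=> mO O0.
(* The pair of ends is read off an enumeration of the pairs of rationals. *)
pose B (o : option (rat * rat)) : set R := if o is Some (p, q) then
   if `[< open_itv a b (ratr p) /\ open_itv a b (ratr q) /\ (ratr p : R) <= ratr q >]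
   then Omega `&` `]ratr p, ratr q] else set0 else set0.
have A0 k : leb.-negligible (B (choice.unpickle k)).
  case: (choice.unpickle k) => [[p q]|]; rewrite /B; last exact: negligible_set0.
  case: ifPn => [/asboolP[Dp [Dq pq]]|_]; last exact: negligible_set0.
  apply/negligibleP; first by apply: measurableI => //; exact: itv_lebesgue_measurable.
  apply: null_of_density0 => // t pt tq; apply: O0; exact: open_itv_between Dp Dq pt tq.
have neg : leb.-negligible (Omega `&` open_itv a b).
  apply: negligibleS (negligible_bigcup A0).
  move=> z [Oz Dz]; have [s [t [Ds Dt sz zt]]] := open_itv_neighbours Dz.
  have [p] := rat_in_itvoo sz; rewrite in_itv/= => /andP[sp pz].
  have [q] := rat_in_itvoo zt; rewrite in_itv/= => /andP[zq qt].
  exists (choice.pickle (p, q)); first exact: Logic.I.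
  rewrite choice.pickleK /B; case: ifPn => [_|/asboolP[]].
    by split => //=; rewrite in_itv/= pz ltW.
  split; [|split; last lra]; apply: (open_itv_between Ds Dt); lra.
apply: measure_negligible neg; apply: measurableI => //; exact: open_itv_measurable.
Qed.

Lemma ess_boundary_free_null_or_full Omega (a b : \bar R) : mble Omega ->
  (forall t, open_itv a b t -> ~ ess_boundary Omega t) ->
  leb (Omega `&` open_itv a b) = 0%E \/ leb (~` Omega `&` open_itv a b) = 0%E.
Proof.
move=> mO free; have mC := measurableC mO.
have O01 t : open_itv a b t ->
    density_points 0 Omega t \/ density_points 0 (~` Omega) t.
  move=> /free; rewrite /ess_boundary -density1_setC// => /contrapT.
  by [].
have [all0|/existsNP[d /not_implyP[Dd Od]]] :=
  pselect (forall t, open_itv a b t -> density_points 0 Omega t).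
  by left; exact: leb_null_open_itv.
have [all1|/existsNP[c /not_implyP[Dc Oc]]] :=
  pselect (forall t, open_itv a b t -> density_points 0 (~` Omega) t).
  by right; exact: leb_null_open_itv.
exfalso; have {}Od : density_points 0 (~` Omega) d.
  by have [H|H] := O01 d Dd; [case: (Od H)|exact: H].
have Oc' : density_points 0 Omega c.
  by have [H|H] := O01 c Dc; [exact: H|case: (Oc H)].
have [cd|dc|E] := ltgtP c d; last by apply: Oc; rewrite E; exact: Od.
- apply: (no_jump mO cd _ Oc' Od) => t ct td; apply: O01.
  exact: open_itv_between Dc Dd ct td.
- apply: (no_jump mC dc _ Od); rewrite setCK; last exact: Oc'.
  move=> t dt tc.
  have Dt : open_itv a b t by exact: open_itv_between Dd Dc dt tc.
  by have [H|H] := O01 t Dt; [right; exact: H|left; exact: H].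
Qed.

Lemma not_ess_boundary_of_null Omega (y x z : R) : mble Omega ->
  y < x -> x < z ->
  leb (Omega `&` `]y, x[%classic) = 0%E -> leb (Omega `&` `]x, z[%classic) = 0%E ->
  ~ ess_boundary Omega x.
Proof.
move=> mO yx xz Oy Oz; rewrite /ess_boundary => /(_ _); apply; left.
set r := Num.min (x - y) (z - x).
have r0 : 0 < r by rewrite lt_min !subr_gt0 yx xz.
have ry : r <= x - y by rewrite ge_min lexx.
have rz : r <= z - x by rewrite ge_min lexx orbT.
apply: (density0_of_null r0 mO).
have mI u v : mble (Omega `&` `]u, v[%classic).
  by apply: measurableI => //; exact: itv_lebesgue_measurable.
have n1 : leb.-negligible (Omega `&` `]y, x[%classic) by apply/negligibleP.
have n2 : leb.-negligible (Omega `&` `]x, z[%classic) by apply/negligibleP.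
have n3 : leb.-negligible [set x].
  have m1 := itv_lebesgue_measurable `[x, x]; have := leb_itv true false (lexx x).
  by rewrite set_itv1 in m1 *; rewrite subrr => l0; apply/negligibleP.
apply: measure_negligible.
  by apply: measurableI => //; exact: ball_lebesgue_measurable.
apply: negligibleS (negligibleU (negligibleU n1 n2) n3).
rewrite ball_itv => u [Ou]; rewrite /= in_itv/= => /andP[h1 h2].
have [ux|xu|->] := ltgtP u x; [left; left|left; right|by right].
  by split => //=; rewrite in_itv/= ux andbT; lra.
by split => //=; rewrite in_itv/= xu; lra.
Qed.

End ess_boundary_free_intervals.

(** * The profile of a symmetric log-concave measure *)

Section log_concave_measure.
Context (R : realType) (mu : probability (lebesgueTypeR R) R)
  (f : R -> R) (a b : \bar R).
Hypothesis f_density : has_density mu f.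
Hypothesis f_pos : forall x : R, open_itv a b x -> 0 < f x.
Hypothesis f_zero : forall x : R, ~ open_itv a b x -> f x = 0.
Hypothesis f_log_concave : log_concave_on (open_itv a b) f.
Hypothesis f_symmetric : forall x : R, f (- x) = f x.
Local Notation D := (open_itv a b).
Local Notation F := (cumul mu).
Local Notation J := (J mu f a b).

Lemma density_ge0 x : 0 <= f x.
Proof. by have [/f_pos/ltW//|/f_zero->] := pselect (D x). Qed.

Lemma density_gt0 x : 0 < f x -> D x.
Proof. by move=> fx; apply: contrapT => /f_zero fx0; rewrite fx0 ltxx in fx. Qed.

(** If |u| <= |v| then u lies between v and - v, where V takes the same value,
    so V(u) <= V(v) by convexity. *)
Lemma density_unimodal u v : `|u| <= `|v| -> f v <= f u.
Proof.
move=> uv; have [Dv|/f_zero ->] := pselect (D v); last exact: density_ge0.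
have DNv : D (- v) by apply: density_gt0; rewrite f_symmetric; exact: f_pos.
have [V [cV fV]] := f_log_concave.
have : V (- v) = V v.
  have := f_symmetric v; rewrite !fV// => /expR_inj; exact: oppr_inj.
wlog v0 : v Dv DNv uv / 0 <= v.
  move=> H; have [|v0] := leP 0 v; first exact: H.
  move=> E; rewrite -f_symmetric; apply: H => //; rewrite ?opprK ?normrN//.
  by rewrite oppr_ge0 ltW.
move=> E; rewrite (ger0_norm v0) in uv; move: uv => /ler_normlP[uv1 uv2].
have [v0'|v0'] := eqVneq v 0; first by have -> : u = v; [lra|].
have nvu : - v <= u by lra.
have Du : D u by exact: open_itv_between DNv Dv nvu uv2.
have := convex_chord cV DNv Dv nvu uv2; rewrite E => H.
rewrite !fV// ler_expR lerN2.
have v2 : 0 < 2 * v by rewrite mulr_gt0// lt_neqAle eq_sym v0'.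
rewrite -(ler_pM2l v2); lra.
Qed.

Lemma density_le0 x : f x <= f 0.
Proof. by apply: density_unimodal; rewrite normr0. Qed.

Lemma density0_gt0 : 0 < f 0.
Proof.
rewrite lt_neqAle density_ge0 andbT eq_sym; apply/eqP => f00.
have [//|x [x0 h1 h2]] := @cumul_tails _ mu (1/2).
have nxx : - x <= x by lra.
have := cumulB_le f_density density_ge0 nxx (M := 0); rewrite mul0r.
have fle u : - x < u -> u <= x -> f u <= 0 by rewrite -f00 density_le0.
move=> /(_ fle); lra.
Qed.

(** F(t) + F(- t) is constant: its increments between s and t are bounded by
    (t - s) times the variation of f, which is monotone on each side of 0. The
    constant is identified at infinity. *)
Lemma cumulN x : F (- x) = 1 - F x.
Proof.
have const (y z : R) : 0 <= y -> y <= z -> F z + F (- z) = F y + F (- y).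
  move=> y0 yz; apply/eqP; rewrite eq_le.
  have inc (s t : R) : y <= s -> s <= t -> t <= z ->
      `|(F t - F s) - (F (- s) - F (- t))| <= (t - s) * (f s - f t).
    move=> ys st tz.
    have nst : - t <= - s by lra.
    have s0 : 0 <= s by lra.
    have t0 : 0 <= t by lra.
    have := cumulB_le f_density density_ge0 st (M := f s).
    have := cumulB_ge f_density st (density_ge0 t).
    have := cumulB_le f_density density_ge0 nst (M := f s).
    have := cumulB_ge f_density nst (density_ge0 t).
    have le1 u : s < u -> u <= t -> f u <= f s /\ f t <= f u.
      by move=> su ut; split; apply: density_unimodal; rewrite !ger0_norm; lra.
    have le2 u : - t < u -> u <= - s -> f u <= f s /\ f t <= f u.
      move=> su ut; rewrite -(f_symmetric u).
      by split; apply: density_unimodal; rewrite !ger0_norm; lra.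
    move=> /(_ (fun u h k => proj2 (le2 u h k))) A1.
    move=> /(_ (fun u h k => proj1 (le2 u h k))) A2.
    move=> /(_ (fun u h k => proj2 (le1 u h k))) A3.
    move=> /(_ (fun u h k => proj1 (le1 u h k))) A4.
    by rewrite ler_norml; apply/andP; split; lra.
  apply/andP; split.
    rewrite -lerN2; apply: (le_of_increment_bound (phi := fun t => - (F t + F (- t)))
       (g := fun t => - f t) yz) => s t ys st tz.
    have := inc s t ys st tz; move/ler_normlP => -[h1 h2]; lra.
  apply: (le_of_increment_bound (phi := fun t => (F t + F (- t)))
       (g := fun t => - f t) yz) => s t ys st tz.
  have := inc s t ys st tz; move/ler_normlP => -[h1 h2]; lra.
have F0 : F 0 = 1 / 2.
  apply/eqP; rewrite eq_le; apply/andP; split; apply/ler_addgt0Pr => e e0.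
    have [//|y [y0 h1 h2]] := @cumul_tails _ mu e.
    have := const 0 y (lexx _) y0; rewrite oppr0.
    have := cumul_le1 mu y; lra.
  have [//|y [y0 h1 h2]] := @cumul_tails _ mu e.
  have := const 0 y (lexx _) y0; rewrite oppr0.
  have := cumul_ge0 mu (- y); lra.
have [x0|x0] := leP 0 x.
  have := const 0 x (lexx _) x0; rewrite oppr0 F0; lra.
have := const 0 (- x) (lexx _); rewrite oppr0 F0 opprK => /(_ ltac:(lra)); lra.
Qed.

Lemma cumul0 : F 0 = 1 / 2.
Proof. have := cumulN 0; rewrite oppr0; lra. Qed.

Lemma cumul_increasing x y : D x -> D y -> x < y -> F x < F y.
Proof.
move=> Dx Dy xy; rewrite -subr_gt0.
pose c := Num.min (f x) (f y).
have c0 : 0 < c by rewrite lt_min !f_pos.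
apply: (@lt_le_trans _ _ (c * (y - x))); first by rewrite mulr_gt0// subr_gt0.
apply: (cumulB_ge f_density (ltW xy) (ltW c0)) => u xu uy.
have [xNy|yNx] := leP (`|x|) (`|y|).
  rewrite /c ge_min (@density_unimodal u y) ?orbT//.
  by move: xNy; case: (ger0P u); case: (ger0P x); case: (ger0P y); lra.
rewrite /c ge_min (@density_unimodal u x) //.
by move: yNx; case: (ger0P u); case: (ger0P x); case: (ger0P y); lra.
Qed.

Lemma cumul_outside_right x : 0 <= x -> ~ D x -> F x = 1.
Proof.
move=> x0 Dx; apply/eqP; rewrite eq_le cumul_le1/=.
apply/ler_addgt0Pr => e e0.
have [//|y [y0 h1 h2]] := @cumul_tails _ mu e.
have [yx|xy] := leP y x; first by have := cumul_nondecreasing mu yx; lra.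
have := cumulB_le f_density density_ge0 (ltW xy) (M := 0); rewrite mul0r.
have fle u : x < u -> u <= y -> f u <= 0.
  move=> xu uy; rewrite -(f_zero Dx); apply: density_unimodal.
  by rewrite !ger0_norm; lra.
move=> /(_ fle); lra.
Qed.

Lemma open_itvN x : D (- x) -> D x.
Proof. by move=> Dx; apply: density_gt0; rewrite -f_symmetric; exact: f_pos. Qed.

Lemma cumul_in01 x : (0 < F x < 1) <-> D x.
Proof.
split => [/andP[F0 F1]|Dx].
  apply: contrapT => Dx; have [x0|x0] := leP 0 x.
    by move: F1; rewrite cumul_outside_right// ltxx.
  have : F (- x) = 1 by apply: cumul_outside_right; [lra|move/open_itvN].
  rewrite cumulN; lra.
have [s [t [Ds Dt sx xt]]] := open_itv_neighbours Dx.
have := cumul_increasing Ds Dx sx; have := cumul_increasing Dx Dt xt.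
have := cumul_ge0 mu s; have := cumul_le1 mu t => *; apply/andP; lra.
Qed.

Lemma cumul_lipschitz x y : `|F x - F y| <= f 0 * `|x - y|.
Proof.
wlog yx : x y / y <= x.
  move=> H; have [|/ltW] := leP y x; first exact: H.
  by move=> xy; rewrite distrC [in leRHS]distrC; exact: H.
rewrite !ger0_norm ?subr_ge0//; last exact: cumul_nondecreasing.
by apply: (cumulB_le f_density density_ge0) => // u _ _; exact: density_le0.
Qed.

Lemma cumul_continuous : continuous F.
Proof.
move=> x; apply/cvgrPdist_le => e e0.
have d0 : 0 < e / f 0 by rewrite divr_gt0// density0_gt0.
near=> y; apply: le_trans (cumul_lipschitz x y) _.
rewrite mulrC -ler_pdivlMr ?density0_gt0//; apply: ltW; near: y.
Unshelve. all: by end_near. Qed.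

Lemma cumul_surjective r : 0 < r < 1 -> exists2 x, D x & F x = r.
Proof.
move=> /andP[r0 r1]; have e0 : 0 < Num.min r (1 - r) by rewrite lt_min; lra.
have [x [x0]] := cumul_tails mu e0; rewrite lt_min => /andP[h1 _] h2.
have hr : r < F x.
  have : Num.min r (1 - r) <= 1 - r by rewrite ge_min lexx orbT.
  lra.
have nxx : - x <= x by lra.
have [] := @IVT _ F (- x) x r nxx.
- by apply: continuous_subspaceT; exact: cumul_continuous.
- by rewrite ge_min le_max ltW//= (ltW hr) orbT.
move=> y _ Fy; exists y => //; apply/cumul_in01; rewrite Fy; lra.
Qed.

Lemma cumul_inv_cumul x : D x -> cumul_inv mu a b (F x) = x.
Proof.
move=> Dx; apply: pinvKV; last exact: mem_set.
move=> s t /set_mem Ds /set_mem Dt; have [st|ts|//] := ltgtP s t.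
  by have := cumul_increasing Ds Dt st; lra.
by have := cumul_increasing Dt Ds ts; lra.
Qed.

(** Outside the support F is 0 or 1, and both sides vanish. *)
Lemma J_cumul x : J (F x) = f x.
Proof.
rewrite /Defs.J; case: ifPn => [/cumul_in01 Dx|].
  by rewrite cumul_inv_cumul.
by move=> Fx; rewrite f_zero// => /cumul_in01; exact/negP.
Qed.

Lemma J_outside r : ~~ (0 < r < 1) -> J r = 0.
Proof. by rewrite /Defs.J => /negbTE ->. Qed.

Lemma J_ge0 r : 0 <= J r.
Proof. by rewrite /Defs.J; case: ifP => // _; exact: density_ge0. Qed.

Lemma J_gt0 r : 0 < r < 1 -> 0 < J r.
Proof. by move=> /cumul_surjective[x Dx <-]; rewrite J_cumul f_pos. Qed.

Lemma J_symmetric r : J (1 - r) = J r.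
Proof.
have [/cumul_surjective[x Dx <-]|r01] := boolP (0 < r < 1).
  by rewrite -cumulN !J_cumul f_symmetric.
rewrite !J_outside//; lra.
Qed.

(** The hypothesis says that f(t) exp(- k t) is nondecreasing up to y; formally
    f' >= k f, which integrates to the conclusion. Rigorously, the increments
    of f - k F over [s, t] are at least - f(0) (k (t - s))^2, because
    exp v >= 1 + v. Which end of [s, t] bounds f depends on the sign of k. *)
Lemma density_support_left k x y : D x -> D y -> x <= y ->
  (forall s t, D s -> s <= t -> t <= y -> f s * expR (k * (t - s)) <= f t) ->
  f x <= f y + k * (F x - F y).
Proof.
move=> Dx Dy xy H.
suff : f x - k * F x <= f y - k * F y by lra.
apply: (le_of_increment_bound (phi := fun t => f t - k * F t)
       (g := fun t => f 0 * k ^+ 2 * t) xy) => s t xs st ty.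
have Ds : D s by apply: open_itv_between Dx Dy xs _; lra.
have Hst := H s t Ds st ty.
have f0 := density0_gt0.
set h := t - s; have h0 : 0 <= h by rewrite subr_ge0.
have -> : h * (f 0 * k ^+ 2 * t - f 0 * k ^+ 2 * s) = f 0 * (k * h) ^+ 2.
  by rewrite /h; ring.
set v := k * h in Hst *.
have v2 : 0 <= v ^+ 2 by exact: sqr_ge0.
have [k0|k0] := leP 0 k.
  have v0 : 0 <= v by rewrite mulr_ge0.
  have Fle : F t - F s <= f t * h.
    apply: (cumulB_le f_density density_ge0) => // u su ut.
    have Du : D u by apply: open_itv_between Dx Dy _ _; lra.
    apply: le_trans (H u t Du ut ty); rewrite ler_peMr ?density_ge0//.
    by rewrite -[leLHS]expR0 ler_expR mulr_ge0// subr_ge0.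
  have kF : k * (F t - F s) <= f t * v.
    by have := ler_wpM2l k0 Fle; rewrite /v; lra.
  have fs : f s * (1 + v) <= f t.
    by apply: le_trans Hst; rewrite ler_wpM2l ?density_ge0// expR_ge1Dx.
  have fs' : f s <= f t * (1 - v + v ^+ 2).
    have v1 : 0 < 1 + v by lra.
    rewrite -(ler_pM2r v1); apply: le_trans fs _.
    have -> : f t * (1 - v + v ^+ 2) * (1 + v) = f t + f t * (v ^+ 2 * v) by ring.
    by rewrite lerDl !mulr_ge0// density_ge0.
  have : f t * v ^+ 2 <= f 0 * v ^+ 2 by rewrite ler_wpM2r// density_le0.
  lra.
have v0 : v <= 0 by rewrite /v nmulr_rle0.
have fs0 : 0 <= f s by exact: density_ge0.
have Fge : f s * (1 + v) * h <= F t - F s.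
  have [neg|pos] := ltP (1 + v) 0.
    apply: (@le_trans _ _ 0); last by rewrite subr_ge0 cumul_nondecreasing.
    by rewrite mulr_le0_ge0// mulr_ge0_le0// ltW.
  apply: (cumulB_ge f_density) => //; first exact: mulr_ge0.
  move=> u su ut; have uy : u <= y by lra.
  apply: le_trans (H s u Ds (ltW su) uy); rewrite ler_wpM2l//.
  apply: le_trans (expR_ge1Dx _); rewrite lerD2l /v.
  by apply: (ler_wnM2l (ltW k0)); rewrite /h lerD2r.
have kF : - v * (f s * (1 + v)) <= - k * (F t - F s).
  have nk : 0 <= - k by lra.
  by have := ler_wpM2l nk Fge; rewrite /v; lra.
have fs : f s * (1 + v) <= f t.
  by apply: le_trans Hst; rewrite ler_wpM2l ?density_ge0// expR_ge1Dx.
have : f s * v ^+ 2 <= f 0 * v ^+ 2 by rewrite ler_wpM2r// density_le0.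
have -> : f s * v ^+ 2 = v * (f s * v) by ring.
lra.
Qed.

(** The points on the right of y are reduced to those on the left by the
    reflection through the origin. *)
Lemma density_support y : D y ->
  exists k, forall x, D x -> f x <= f y + k * (F x - F y).
Proof.
move=> Dy; have [V [cV fV]] := f_log_concave.
have [c [cL cR]] := convex_subgradient cV Dy.
exists (- c) => x Dx; have [xy|/ltW yx] := leP x y.
  apply: density_support_left => // s t Ds st ty.
  have Dt : D t by exact: open_itv_between Ds Dy st ty.
  rewrite !fV// -expRD ler_expR.
  have := cL s t Ds st ty; lra.
have DN z : D z -> D (- z) by move=> Dz; apply: open_itvN; rewrite opprK.
have nyx : - x <= - y by lra.
have := density_support_left (k := c) (DN _ Dx) (DN _ Dy) nyx.
rewrite !f_symmetric !cumulN => H.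
suff : f x <= f y + c * (1 - F x - (1 - F y)) by lra.
apply: H => s t Ds st ty.
have Dt : D t by exact: open_itv_between Ds (DN _ Dy) st ty.
rewrite -(f_symmetric s) -(f_symmetric t) (fV _ (DN _ Ds)) (fV _ (DN _ Dt)).
rewrite -expRD ler_expR.
have yt : y <= - t by lra.
have nst : - t <= - s by lra.
have := cR (- t) (- s) (DN _ Ds) yt nst; lra.
Qed.

Lemma J_support r : 0 < r < 1 ->
  exists k, forall s, 0 <= s <= 1 -> J s <= J r + k * (s - r).
Proof.
move=> r01; have /cumul_surjective[y Dy Fy] := r01.
have [k Hk] := density_support Dy.
have inside s : 0 < s < 1 -> J s <= J r + k * (s - r).
  by move=> /cumul_surjective[x Dx <-]; rewrite -Fy !J_cumul Hk.
have pos s : 0 < s < 1 -> 0 <= J r + k * (s - r).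
  by move=> s01; apply: le_trans (J_ge0 s) (inside _ s01).
exists k => s s01; have [/inside//|s01'] := boolP (0 < s < 1).
rewrite J_outside// leNgt; apply/negP => neg.
(* The affine bound is nonnegative on the open interval, hence at its ends. *)
set A := J r + k * (s - r) in neg.
have half : 0 < (1/2 : R) < 1 by lra.
have := pos _ half.
have [s0|s1] : s = 0 \/ s = 1 by have [->|] := eqVneq s 0; [left|right; lra].
- move=> H; have kA : 2 * - A <= k by rewrite /A s0; lra.
  have k0 : 0 < k by lra.
  have := pos (- A / (2 * k)).
  have -> : J r + k * (- A / (2 * k) - r) = A / 2 by rewrite /A s0; field; lra.
  have -> : (0 < - A / (2 * k) < 1).
    by rewrite ltr_pdivrMr ?divr_gt0//; lra.
  by move=> /(_ isT); lra.
- move=> H; have kA : 2 * - A <= - k by rewrite /A s1; lra.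
  have k0 : 0 < - k by lra.
  have := pos (1 + A / (2 * - k)).
  have -> : J r + k * (1 + A / (2 * - k) - r) = A / 2 by rewrite /A s1; field; lra.
  have -> : (0 < 1 + A / (2 * - k) < 1).
    rewrite -ltrBlDl ltr_pdivlMr ?gtrDl ?mulr_gt0// pmulr_llt0 ?invr_gt0 ?mulr_gt0//; lra.
  by move=> /(_ isT); lra.
Qed.

(** The point t lies between r and 1 - r, where J takes the same value. *)
Lemma J_nondecreasing r t : 0 <= r -> r <= t -> t <= 1 / 2 -> J r <= J t.
Proof.
move=> r0 rt t1; have [t0|t0] := leP t 0.
  by have -> : r = t by lra.
have [k Hk] := J_support (r := t) ltac:(lra).
have h1 := Hk r ltac:(lra).
have := Hk (1 - r) ltac:(lra); rewrite J_symmetric => h2.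
have [k0|k0] := leP 0 k.
  have : k * (r - t) <= 0 by rewrite mulr_ge0_le0//; lra.
  lra.
have : k * (1 - r - t) <= 0 by rewrite mulr_le0_ge0//; lra.
lra.
Qed.

(** * Negligible sets and the discreteness of the boundary *)

Local Notation leb := (@completed_lebesgue_measure R).
Local Notation mble A := (measurable (A : set (lebesgueTypeR R))).
Local Notation m A := (fine (mu A)).

Lemma negligible_density (A : set R) : leb.-negligible A -> mu.-negligible A.
Proof.
move=> [B [mB B0 AB]]; exists B; split => //.
have := density_le f_density density_ge0 mB (fun x _ => density_le0 x).
by rewrite B0 mule0 => h; apply/eqP; rewrite eq_le h measure_ge0.
Qed.

Lemma negligible_outside : mu.-negligible (~` D).
Proof.
have mD : mble (~` D) by apply: measurableC; exact: open_itv_measurable.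
exists (~` D); split => //; apply/eqP; rewrite eq_le measure_ge0 andbT.
have fle x : (~` D) x -> f x <= 0 by move=> /f_zero ->.
by have := density_le f_density density_ge0 mD fle; rewrite mul0e.
Qed.

Lemma negligible_point x : mu.-negligible [set x].
Proof.
apply: negligible_density.
have m1 := itv_lebesgue_measurable `[x, x]; have := leb_itv true false (lexx x).
by rewrite set_itv1 in m1 *; rewrite subrr => l0; apply/negligibleP.
Qed.

Lemma le_prob (A B : set R) : mble A -> mble B -> A `<=` B -> m A <= m B.
Proof.
move=> mA mB AB; rewrite -lee_fin -!fin_mu//; apply: le_measure => //; exact: mem_set.
Qed.

Lemma prob_negligible (A : set R) : mble A -> mu.-negligible A -> m A = 0.
Proof. by move=> mA A0; rewrite (measure_negligible mA A0). Qed.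

Lemma probU_le (A B : set R) : mble A -> mble B -> m (A `|` B) <= m A + m B.
Proof.
move=> mA mB; rewrite -lee_fin EFinD -!fin_mu//; last exact: measurableU.
exact: measureU2.
Qed.

Lemma prob_split (A B : set R) : mble A -> mble B -> m A = m (A `&` B) + m (A `\` B).
Proof.
move=> mA mB; apply: EFin_inj; rewrite EFinD -!fin_mu//; first last.
- exact: measurableI.
- exact: measurableD.
by rewrite addeC -measureDI.
Qed.

(** By unimodality every point of E in the ball adds at least f(x) to the
    perimeter. *)
Lemma finite_boundary (E : set R) x : 0 < f x ->
  (\esum_(u in E) (f u)%:E < +oo)%E ->
  finite_set (E `&` [set u | `|u| <= `|x|]).
Proof.
move=> fx fin; apply: contrapT => /infinite_set_fset inf.
have P0 : (0 <= \esum_(u in E) (f u)%:E)%E.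
  by apply: esum_ge0 => u _; rewrite lee_fin density_ge0.
have /fineK PE : \esum_(u in E) (f u)%:E \is a fin_num by rewrite ge0_fin_numE.
set P := fine _ in PE.
have [B BE cardB] := inf (Num.truncn (P / f x)).+1.
have : (\sum_(u \in [set` B]) (f u)%:E <= P%:E)%E.
  rewrite PE; apply: ereal_sup_ubound; exists [set` B] => //.
  by split; [exact: finite_fset|move=> u /BE []].
rewrite fsbig_finite; last exact: finite_fset.
rewrite set_fsetK sumEFin lee_fin leNgt => /negP; apply.
have := Num.Theory.truncnS_gt (P / f x); rewrite ltr_pdivrMr// => h.
apply: lt_le_trans h _.
apply: (@le_trans _ _ (\sum_(u <- B) f x)).
  rewrite big_const_seq count_predT iter_addr_0 -[f x *+ _]mulr_natl ler_pM2r// ler_nat.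
  exact: cardB.
rewrite big_seq [leRHS]big_seq; apply: ler_sum => u uB.
by apply: density_unimodal; have [_] := BE u uB.
Qed.

Lemma finite_norm_min (S : set R) : finite_set S -> S !=set0 ->
  exists2 x, S x & forall u, S u -> `|x| <= `|u|.
Proof.
move=> /finite_seqP[s ->]; elim: s => [[] //|y s IH _].
have [[x xs Hx]|s0] := pselect (exists2 x, x \in s & forall u, u \in s -> `|x| <= `|u|).
  have [xy|/ltW yx] := leP `|x| `|y|.
    exists x => /=; first by rewrite inE xs orbT.
    by move=> u; rewrite inE => /orP[/eqP ->//|/Hx].
  exists y => /=; first by rewrite inE eqxx.
  by move=> u; rewrite inE => /orP[/eqP ->//|/Hx]; exact: le_trans.
exists y => /=; first by rewrite inE eqxx.
move=> u; rewrite inE => /orP[/eqP ->//|us]; exfalso; apply: s0.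
by apply: IH; exists u.
Qed.

(** Only finitely many points of T are closer to the origin than a given one. *)
Lemma boundary_innermost (E T : set R) : (\esum_(u in E) (f u)%:E < +oo)%E ->
  T `<=` E `&` D -> T !=set0 ->
  exists2 x, T x & forall u, T u -> `|x| <= `|u|.
Proof.
move=> fin TE [x0 Tx0]; have [Ex0 Dx0] := TE _ Tx0.
have finT : finite_set (T `&` [set u | `|u| <= `|x0|]).
  apply: sub_finite_set (finite_boundary (f_pos Dx0) fin).
  by move=> u [/TE[]].
have [|x [Tx xx0] Hx] := finite_norm_min finT; first by exists x0; split => /=.
exists x => // u Tu; have [ux0|/ltW x0u] := leP `|u| `|x0|; first exact: Hx.
exact: le_trans xx0 x0u.
Qed.

Lemma esum_ge1 (E : set R) x : E x -> ((f x)%:E <= \esum_(u in E) (f u)%:E)%E.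
Proof.
move=> Ex; apply: esum_ge; exists [set x]; last by rewrite fsbig_set1.
by split; [exact: finite_set1|move=> u ->].
Qed.

Lemma esum_ge2 (E : set R) x y : E x -> E y -> x != y ->
  ((f x + f y)%:E <= \esum_(u in E) (f u)%:E)%E.
Proof.
move=> Ex Ey xy; apply: esum_ge; exists ([set x] `|` [set y]).
  by split; [rewrite finite_setU; split; exact: finite_set1|move=> u [->|->]].
rewrite fsbigU0 ?fsbig_set1//; try exact: finite_set1.
by move=> u [/= -> E']; move/eqP: xy; apply.
Qed.

(** * First boundary points on each side *)

(** The two orientations of the line are treated together: sg is 1 or -1, and
    ray sg x is the half-line that starts at sg x in the direction sg. *)
Definition ray (sg x : R) : set R := [set u | x < sg * u].

Lemma ray_itv (sg x : R) : sg = 1 \/ sg = -1 ->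
  ray sg x = if sg == 1 then `]x, +oo[%classic else `]-oo, - x[%classic.
Proof.
have n11 : (-1 == 1 :> R) = false by apply/negbTE/eqP; lra.
case=> ->; rewrite ?eqxx ?n11; apply/seteqP; split => u /=;
  rewrite /ray/= in_itv/= ?andbT ?mul1r ?mulN1r; lra.
Qed.

Lemma ray_measurable (sg x : R) : sg = 1 \/ sg = -1 -> mble (ray sg x).
Proof. by move=> /ray_itv ->; case: ifP => _; exact: itv_lebesgue_measurable. Qed.

Lemma probC (A : set R) : mble A -> m (~` A) = 1 - m A.
Proof.
move=> mA; apply: EFin_inj; rewrite EFinB -!fin_mu//; last exact: measurableC.
exact: probability_setC.
Qed.

Lemma prob_ray (sg x : R) : sg = 1 \/ sg = -1 -> m (ray sg x) = 1 - F x.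
Proof.
move=> sgP; rewrite ray_itv//; case: ifP => _.
  by rewrite -setCitvl probC//; exact: itv_lebesgue_measurable.
rewrite -cumulN /cumul.
have mI := itv_lebesgue_measurable `]-oo, - x[.
have mI' := itv_lebesgue_measurable `]-oo, - x].
apply/eqP; rewrite eq_le; apply/andP; split.
  by apply: le_prob => // u /=; rewrite !in_itv/=; exact: ltW.
have m1 : mble [set - x] by have := itv_lebesgue_measurable `[- x, - x]; rewrite set_itv1.
apply: (@le_trans _ _ (m (`]-oo, (- x)[%classic `|` [set - x]))).
  apply: le_prob => //; first exact: measurableU.
  move=> u /=; rewrite !in_itv/= le_eqVlt => /orP[/eqP ->|]; by [right|left].
apply: le_trans (probU_le mI m1) _.
by rewrite (prob_negligible m1 (negligible_point _)) addr0.
Qed.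

Lemma mul_sgK (sg x : R) : sg = 1 \/ sg = -1 -> sg * (sg * x) = x.
Proof. by case=> ->; ring. Qed.

Lemma norm_sg (sg x : R) : sg = 1 \/ sg = -1 -> `|sg * x| = `|x|.
Proof. by case=> ->; rewrite ?mul1r// mulN1r normrN. Qed.

Lemma open_itv_norm u v : `|u| <= `|v| -> D v -> D u.
Proof.
by move=> uv Dv; apply: density_gt0; exact: lt_le_trans (f_pos Dv) (density_unimodal uv).
Qed.

Lemma signed_gap_itv (sg x z : R) : sg = 1 \/ sg = -1 ->
  exists u v : \bar R, [set t | x < sg * t < z] = open_itv u v.
Proof.
case=> ->; [exists x%:E, z%:E|exists (- z)%:E, (- x)%:E];
  by apply/seteqP; split => t /=; rewrite /open_itv/= !lte_fin; lra.
Qed.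

Lemma signed_tail_itv (sg x : R) : sg = 1 \/ sg = -1 -> D x ->
  exists u v : \bar R, D `&` ray sg x = open_itv u v.
Proof.
move=> sgP Dx; have DN : D (- x) by apply: open_itvN; rewrite opprK.
case: sgP => ->; [exists x%:E, b|exists a, (- x)%:E];
  apply/seteqP; split => t; rewrite /open_itv/ray/= ?mul1r ?mulN1r ?lte_fin.
- by move=> [/andP[_ ->] ->].
- move=> /andP[xt ->]; rewrite xt andbT; split => //.
  by move/andP : Dx => [ax _]; apply: lt_trans ax _; rewrite lte_fin.
- by move=> [/andP[-> _]]; rewrite ltrNr => ->.
- move=> /andP[->]; rewrite ltrNr => xt; split => //=.
  by move/andP : DN => [_]; apply: lt_trans; rewrite lte_fin ltrNr.
Qed.

Lemma signed_not_boundary (Omega : set R) (sg x r : R) :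
  sg = 1 \/ sg = -1 -> mble Omega ->
  0 < r -> leb.-negligible (Omega `&` [set u | x - r < sg * u < x]) ->
  leb.-negligible (Omega `&` [set u | x < sg * u < x + r]) ->
  ~ ess_boundary Omega (sg * x).
Proof.
move=> sgP mO r0 n1 n2.
have mI u v : mble (Omega `&` `]u, v[%classic).
  by apply: measurableI => //; exact: itv_lebesgue_measurable.
case: sgP n1 n2 => -> n1 n2; rewrite ?mul1r ?mulN1r.
- apply: (@not_ess_boundary_of_null _ _ (x - r) x (x + r)) => //; [lra|lra| |].
    apply: measure_negligible => //; apply: negligibleS n1; apply: setIS => u /=.
    by rewrite in_itv/= mul1r.
  apply: measure_negligible => //; apply: negligibleS n2; apply: setIS => u /=.
  by rewrite in_itv/= mul1r.
- apply: (@not_ess_boundary_of_null _ _ (- x - r) (- x) (- x + r)) => //; [lra|lra| |].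
    apply: measure_negligible => //; apply: negligibleS n2; apply: setIS => u /=.
    by rewrite in_itv/= mulN1r; lra.
  apply: measure_negligible => //; apply: negligibleS n1; apply: setIS => u /=.
  by rewrite in_itv/= mulN1r; lra.
Qed.

Lemma null_or_full_negligible (Omega A : set R) (u v : \bar R) : mble Omega ->
  A = open_itv u v -> (forall t, A t -> ~ ess_boundary Omega t) ->
  leb.-negligible (Omega `&` A) \/ leb.-negligible (~` Omega `&` A).
Proof.
move=> mO -> free; have mI := open_itv_measurable u v.
have [h|h] := ess_boundary_free_null_or_full mO free; [left|right].
- by apply/negligibleP => //; exact: measurableI.
- by apply/negligibleP => //; apply: measurableI => //; exact: measurableC.
Qed.

(** One side of the structure of a set that is null around the origin: S is the
    side, and Z the central region. The half-line H starts at the first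
    boundary point x, so its profile J(mu H) is f(x); it is empty if there is
    no boundary point on this side. Just before x the set is null, so it is full
    just after x and up to the next boundary point x', which makes J(mu(H\Omega))
    at most f(x'). The region Z reaches the distance y on the other side of
    the origin, so that the set is null just before x also when x is 0. *)
Lemma half_line_side (Omega : set R) (sg : R) (S Z : set R) (y : R) : sg = 1 \/ sg = -1 ->
  mble Omega -> mble S ->
  (forall u, S u -> 0 <= sg * u) -> (forall u, 0 < sg * u -> S u) ->
  leb.-negligible (Omega `&` Z) -> 0 <= y -> D y -> (forall u, S u -> - y < sg * u) ->
  (forall u, D u -> - y < sg * u ->
    (forall e, ess_boundary Omega e -> D e -> S e -> sg * u < sg * e) -> Z u) ->
  (perimeter f Omega < +oo)%E ->
  exists H : set R, [/\ mble H,
    forall u v, H u -> sg * u <= sg * v -> H v,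
    mu.-negligible ((Omega `&` S) `\` H),
    m H <= 1 / 2 &
    ((J (m H) + J (m (H `\` Omega)))%:E <=
      \esum_(u in ess_boundary Omega `&` S) (f u)%:E)%E].
Proof.
move=> sgP mO mS S0 S1 OZ y0 Dy Sy HZ fin.
set E := ess_boundary Omega in fin HZ *.
have muZ : mu.-negligible ((Omega `&` Z) `|` ~` D).
  by apply: negligibleU; [exact: negligible_density|exact: negligible_outside].
pose T := [set e | [/\ E e, D e & S e]].
have TE : T `<=` E `&` D by move=> e [].
have [T0|/set0P/(boundary_innermost fin TE)] := eqVneq T set0.
  exists set0; split => //; first last.
  - rewrite set0D measure0/= J_outside ?ltxx// addr0.
    by apply: esum_ge0 => u _; rewrite lee_fin density_ge0.
  - by rewrite measure0/=; lra.
  apply: negligibleS muZ => u [[Ou Su] _].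
  have [Du|Du] := pselect (D u); [left; split => //|by right].
  apply: HZ => //; first exact: Sy.
  by move=> e Ee De Se; have : T e by []; rewrite T0.
move=> [x0 [Ex0 Dx0 Sx0] first].
set x := sg * x0; have x0E : x0 = sg * x by rewrite mul_sgK.
have xge0 : 0 <= x by exact: S0.
have Dx : D x by apply: open_itv_norm Dx0; rewrite norm_sg.
have fx : f x = f x0.
  by rewrite /x; case: sgP => ->; rewrite ?mul1r// mulN1r f_symmetric.
have first' e : E e -> D e -> S e -> x <= sg * e.
  move=> Ee De Se; have := first e (And3 Ee De Se).
  by rewrite -(norm_sg e sgP) -(norm_sg x0 sgP) !ger0_norm//; exact: S0.
have mH : mble (ray sg x) by exact: ray_measurable.
have mHO : mble (ray sg x `\` Omega) by exact: measurableD.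
have probH : m (ray sg x) = 1 - F x by exact: prob_ray.
have F0x : 1 / 2 <= F x by rewrite -cumul0 cumul_nondecreasing.
have JH : J (m (ray sg x)) = f x0 by rewrite probH J_symmetric J_cumul.
(* The set is null just before x, so it cannot be null just after x. *)
have notnull (A : set R) z : x < z ->
    (forall u, x < sg * u -> sg * u < z -> D u -> A u) ->
    ~ leb.-negligible (Omega `&` A).
  move=> xz HA OA.
  have [s [t [Ds Dt sx xt]]] := open_itv_neighbours Dx.
  have xy0 : 0 < x + y by have := Sy _ Sx0; rewrite -/x; lra.
  set r := Num.min (x + y) (Num.min (z - x) (t - x)).
  have r0 : 0 < r by rewrite !lt_min xy0 !subr_gt0 xz xt.
  have [ry [rz rt]] : r <= x + y /\ r <= z - x /\ r <= t - x.
    by rewrite /r !ge_min !lexx ?orbT.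
  suff : ~ E (sg * x) by rewrite -x0E.
  apply: (signed_not_boundary sgP mO r0).
  - apply: negligibleS OZ => u [Ou /=]/andP[h1 h2]; split => //; apply: HZ.
    + have [ux|xu] := leP `|sg * u| x.
        by apply: open_itv_norm Dx; rewrite -(norm_sg u sgP) (ger0_norm xge0).
      apply: open_itv_norm Dy; rewrite -(norm_sg u sgP) (ger0_norm y0).
      by move: xu; case: (ger0P (sg * u)); lra.
    + lra.
    + by move=> e Ee De Se; apply: lt_le_trans h2 _; exact: first'.
  - apply: negligibleS OA => u [Ou /=]/andP[h1 h2]; split => //; apply: HA; [lra|lra|].
    by apply: open_itv_norm Dt; rewrite -(norm_sg u sgP) !ger0_norm; lra.
exists (ray sg x); split => //.
- by move=> u v; rewrite /ray/=; exact: lt_le_trans.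
- apply: negligibleS (negligibleU muZ (negligible_point x0)) => u [[Ou Su] Hu].
  have [ux0|ux0] := eqVneq u x0; first by right.
  have [Du|Du] := pselect (D u); [left; left; split => //|by left; right].
  apply: HZ => //; first exact: Sy.
  move=> e Ee De Se; apply: lt_le_trans (first' e Ee De Se).
  rewrite lt_neqAle leNgt; apply/andP; split; last exact/negP.
  by apply: contraNneq ux0 => ux; rewrite x0E -ux mul_sgK.
- lra.
rewrite JH.
pose T' := [set e | [/\ E e, D e & x < sg * e]].
have TE' : T' `<=` E `&` D by move=> e [].
have [T0'|/set0P/(boundary_innermost fin TE')] := eqVneq T' set0.
  have [u [v uv]] := signed_tail_itv sgP Dx.
  have [|null|full] := null_or_full_negligible mO uv.
  - by move=> t [Dt xt] Et; have : T' t by []; rewrite T0'.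
  - exfalso; apply: (notnull _ (x + 1) _ _ null); first lra.
    by move=> t xt _ Dt; split.
  - have -> : m (ray sg x `\` Omega) = 0.
      apply: prob_negligible => //.
      apply: negligibleS (negligibleU (negligible_density full) negligible_outside).
      by move=> t [Ht Ot]; have [Dt|Dt] := pselect (D t); [left|right].
    by rewrite J_outside ?ltxx// addr0; exact: esum_ge1.
move=> [x1 [Ex1 Dx1 xx1] second].
have [u [v uv]] := signed_gap_itv x (sg * x1) sgP.
have gapD t : x < sg * t < sg * x1 -> D t.
  move=> /andP[h1 h2]; apply: open_itv_norm Dx1.
  by rewrite -(norm_sg t sgP) -(norm_sg x1 sgP) !ger0_norm; lra.
have [|null|full] := null_or_full_negligible mO uv.
- move=> t /= xt Et; have /andP[h1 h2] := xt.
  have := second t (And3 Et (gapD t xt) h1).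
  by rewrite -(norm_sg t sgP) -(norm_sg x1 sgP) !ger0_norm; lra.
- by exfalso; apply: notnull xx1 _ null => t h1 h2 _ /=; rewrite h1.
have m1 : m (ray sg x `\` Omega) <= 1 - F (sg * x1).
  rewrite -(prob_ray (sg * x1) sgP).
  have mr1 := ray_measurable (sg * x1) sgP.
  have mG : mble (~` Omega `&` [set t | x < sg * t < sg * x1]).
    by rewrite uv; apply: measurableI; [exact: measurableC|exact: open_itv_measurable].
  have mp : mble [set x1] by have := itv_lebesgue_measurable `[x1, x1]; rewrite set_itv1.
  have mGp := measurableU _ _ mG mp.
  apply: (@le_trans _ _ (m (ray sg (sg * x1) `|`
      ((~` Omega `&` [set t | x < sg * t < sg * x1]) `|` [set x1])))).
    apply: le_prob => //; first exact: measurableU.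
    move=> t [xt Ot]; have [h|h|h] := ltgtP (sg * t) (sg * x1).
    + by right; left; split => //=; rewrite h andbT.
    + by left.
    + by right; right; rewrite /= -(mul_sgK t sgP) h mul_sgK.
  apply: le_trans (probU_le mr1 mGp) _.
  rewrite (prob_negligible mGp) ?addr0//; apply: negligibleU.
    exact: negligible_density.
  exact: negligible_point.
have x1ge0 : 0 <= sg * x1 by exact: le_trans xge0 (ltW xx1).
have Fx1 : 1 / 2 <= F (sg * x1) by rewrite -cumul0 cumul_nondecreasing.
have fx1 : f (sg * x1) = f x1.
  by case: sgP => ->; rewrite ?mul1r// mulN1r f_symmetric.
have Jle : J (m (ray sg x `\` Omega)) <= f x1.
  rewrite -fx1 -J_cumul -[leRHS]J_symmetric; apply: J_nondecreasing => //; last lra.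
  exact: fine_ge0.
have Sx1 : S x1 by apply: S1; exact: le_lt_trans xge0 xx1.
apply: (@le_trans _ _ (f x0 + f x1)%:E); first by rewrite lee_fin lerD2l.
apply: esum_ge2 => //.
by apply: contraTneq xx1 => <-; rewrite ltxx.
Qed.

(** * Half-lines, asymmetry and deficit *)

(** Half-lines in the direction sg, whether closed, open, empty or full. *)
Definition upward (sg : R) (H : set R) :=
  forall u v, H u -> sg * u <= sg * v -> H v.

Lemma upward_nested sg (H K : set R) : upward sg H -> upward sg K ->
  H `<=` K \/ K `<=` H.
Proof.
move=> uH uK; have [HK|] := pselect (H `<=` K); first by left.
move=> /existsNP[u /not_implyP[Hu Ku]]; right => v Kv.
have [uv|/ltW vu] := leP (sg * u) (sg * v); first exact: uH Hu uv.
by case: Ku; exact: uK Kv vu.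
Qed.

Lemma upwardC sg (H : set R) : upward sg H -> upward (- sg) (~` H).
Proof. by move=> uH u v Hu uv Hv; apply: Hu; apply: uH Hv _; lra. Qed.

Lemma setY_measurable (A B : set R) : mble A -> mble B -> mble (A `+` B).
Proof. by move=> mA mB; apply: measurableU; exact: measurableD. Qed.

Lemma prob_setY (A B : set R) : mble A -> mble B ->
  m (A `+` B) = m (A `\` B) + m (B `\` A).
Proof.
move=> mA mB; apply: EFin_inj; rewrite EFinD -!fin_mu//;
  [|exact: measurableD|exact: measurableD|exact: setY_measurable].
rewrite /setY measureU//; [exact: measurableD|exact: measurableD|].
by apply/seteqP; split => u //= -[[Au Bu] [Bu' Au']].
Qed.

Lemma prob_setY_nested sg (H K : set R) : mble H -> mble K ->
  upward sg H -> upward sg K -> m (H `+` K) = `|m H - m K|.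
Proof.
move=> mH mK uH uK; rewrite prob_setY// (prob_split mH mK) (prob_split mK mH) setIC.
have [HK|KH] := upward_nested uH uK.
  rewrite (_ : H `\` K = set0) ?measure0/=; last by rewrite setD_eq0.
  by rewrite addr0 add0r opprD addrA subrr add0r normrN ger0_norm ?fine_ge0.
rewrite (_ : K `\` H = set0) ?measure0/=; last by rewrite setD_eq0.
by rewrite !addr0 addrAC subrr add0r ger0_norm ?fine_ge0.
Qed.

Lemma prob_setY_triangle (A B C : set R) : mble A -> mble B -> mble C ->
  m (A `+` C) <= m (A `+` B) + m (B `+` C).
Proof.
move=> mA mB mC.
have mAB := setY_measurable mA mB; have mBC := setY_measurable mB mC.
apply: le_trans (probU_le mAB mBC); apply: le_prob.
- exact: setY_measurable.
- exact: measurableU.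
- move=> u /= [[hA hC]|[hC hA]]; have [hB|hB] := pselect (B u).
  + by right; left.
  + by left; left.
  + by left; right.
  + by right; right.
Qed.

Lemma prob_dist_le_setY (A B : set R) : mble A -> mble B ->
  `|m A - m B| <= m (A `+` B).
Proof.
move=> mA mB; rewrite prob_setY// (prob_split mA mB) (prob_split mB mA) setIC.
have h1 : 0 <= m (A `\` B) by exact: fine_ge0.
have h2 : 0 <= m (B `\` A) by exact: fine_ge0.
by rewrite ler_norml; apply/andP; split; lra.
Qed.

Lemma prob_setT : m [set: R] = 1.
Proof. by rewrite probability_setT. Qed.

Lemma upper_half_line r : 0 <= r <= 1 ->
  let K := [set x : R | (cumul_inv_ext mu a b (1 - r) < x%:E)%E] in
  [/\ mble K, upward 1 K & m K = r].
Proof.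
move=> r01 K; split; last first.
- rewrite /K /cumul_inv_ext; case: eqP => [r1|/eqP r1].
    rewrite (_ : mkset _ = setT) ?prob_setT; first lra.
    by apply/seteqP; split => x //= _; rewrite ltNyr.
  case: eqP => [r0|/eqP r0].
    rewrite (_ : mkset _ = set0) ?measure0/=; first lra.
    by apply/seteqP; split => x //=.
  have /cumul_surjective[x Dx Fx] : 0 < 1 - r < 1.
    by rewrite !lt_neqAle eq_sym r1 r0/=; lra.
  rewrite -Fx cumul_inv_cumul// (_ : mkset _ = ray 1 x).
    by rewrite prob_ray; [lra|left].
  by apply/seteqP; split => y /=; rewrite /ray/= mul1r lte_fin.
- by move=> u v; rewrite /K/= !mul1r => h uv; apply: lt_le_trans h _; rewrite lee_fin.
- have -> : K = open_itv (cumul_inv_ext mu a b (1 - r)) +oo%E.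
    by apply/seteqP; split => x; rewrite /K/open_itv/= ltry andbT.
  exact: open_itv_measurable.
Qed.

Lemma lower_half_line r : 0 <= r <= 1 ->
  let K := [set x : R | (x%:E < cumul_inv_ext mu a b r)%E] in
  [/\ mble K, upward (- 1) K & m K = r].
Proof.
move=> r01 K; split; last first.
- rewrite /K /cumul_inv_ext; case: eqP => [->|/eqP r0].
    rewrite (_ : mkset _ = set0) ?measure0//.
    by apply/seteqP; split => x //=.
  case: eqP => [->|/eqP r1].
    rewrite (_ : mkset _ = setT) ?prob_setT//.
    by apply/seteqP; split => x //= _; rewrite ltry.
  have /cumul_surjective[x Dx Fx] : 0 < r < 1.
    by rewrite !lt_neqAle eq_sym r1 r0/=; lra.
  rewrite -Fx cumul_inv_cumul// (_ : mkset _ = ray (- 1) (- x)).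
    by rewrite prob_ray ?cumulN; [lra|right].
  by apply/seteqP; split => y /=; rewrite /ray/= mulN1r lte_fin ltrN2.
- move=> u v; rewrite /K/= !mulN1r lerN2 => h uv; apply: le_lt_trans h.
  by rewrite lee_fin.
- have -> : K = open_itv -oo%E (cumul_inv_ext mu a b r).
    by apply/seteqP; split => x; rewrite /K/open_itv/= ltNyr.
  exact: open_itv_measurable.
Qed.

(** The half-line K of the asymmetry has the mass of Omega and is nested with
    H, so the distance from H to K is |mu H - mu Omega|, which is at most the
    distance from H to Omega. *)
Lemma asymmetry_le_half_line sg (Omega H : set R) : sg = 1 \/ sg = -1 ->
  mble Omega -> mble H -> upward sg H ->
  (asymmetry mu a b Omega <= (2 * m (Omega `+` H))%:E)%E.
Proof.
move=> sgP mO mH uH.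
have close (K : set R) : mble K -> upward sg K -> m K = m Omega ->
    (mu (Omega `+` K) <= (2 * m (Omega `+` H))%:E)%E.
  move=> mK uK KO; rewrite fin_mu; last exact: setY_measurable.
  rewrite lee_fin; apply: le_trans (prob_setY_triangle mO mH mK) _.
  rewrite (prob_setY_nested mH mK uH uK) KO distrC.
  by have := prob_dist_le_setY mO mH; lra.
have O01 : 0 <= m Omega <= 1.
  by rewrite fine_ge0//= -lee_fin -fin_mu// probability_le1.
rewrite /asymmetry ge_min; apply/orP; case: sgP uH close => -> uH close.
  by right; have [mK uK KO] := upper_half_line O01; exact: close.
by left; have [mK uK KO] := lower_half_line O01; exact: close.
Qed.

(** The part of the support between the last negative boundary point and the
    first nonnegative one. The origin is assigned to the right side because it
    may itself be a boundary point, which must then be counted once. *)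
Definition central_gap (E : set R) : set R :=
  [set u | [/\ D u, forall e, E e -> D e -> e < 0 -> e < u
                  & forall e, E e -> D e -> 0 <= e -> u < e]].

Lemma central_gap_itv (E : set R) : (\esum_(u in E) (f u)%:E < +oo)%E ->
  exists u v : \bar R, central_gap E = open_itv u v.
Proof.
move=> fin.
have [u Hu] : exists u : \bar R, forall t, (u < t%:E)%E <->
    (a < t%:E)%E /\ forall e, E e -> D e -> e < 0 -> e < t.
  pose T := [set e | [/\ E e, D e & e < 0]].
  have TE : T `<=` E `&` D by move=> e [].
  have [T0|/set0P/(boundary_innermost fin TE)[e0 [Ee De e0neg] He]] := eqVneq T set0.
    exists a => t; split => [at_|[]//]; split => // e Ee De eneg.
    by have : T e by []; rewrite T0.
  exists e0%:E => t; rewrite lte_fin; split => [e0t|[_]]; last exact.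
  split; first by move/andP: De => [h _]; apply: lt_trans h _; rewrite lte_fin.
  move=> e Ee' De' eneg; apply: le_lt_trans e0t.
  by have := He e (And3 Ee' De' eneg); rewrite !ltr0_norm// lerN2.
have [v Hv] : exists v : \bar R, forall t, (t%:E < v)%E <->
    (t%:E < b)%E /\ forall e, E e -> D e -> 0 <= e -> t < e.
  pose T := [set e | [/\ E e, D e & 0 <= e]].
  have TE : T `<=` E `&` D by move=> e [].
  have [T0|/set0P/(boundary_innermost fin TE)[e0 [Ee De e0pos] He]] := eqVneq T set0.
    exists b => t; split => [tb|[]//]; split => // e Ee De epos.
    by have : T e by []; rewrite T0.
  exists e0%:E => t; rewrite lte_fin; split => [te0|[_]]; last exact.
  split; first by move/andP: De => [_ h]; apply: lt_trans h; rewrite lte_fin.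
  move=> e Ee' De' epos; apply: lt_le_trans te0 _.
  by have := He e (And3 Ee' De' epos); rewrite !ger0_norm.
exists u, v; apply/seteqP; split => t; rewrite /open_itv/=.
  by move=> [/andP[h1 h2] h3 h4]; apply/andP; split; [apply/Hu|apply/Hv].
by move=> /andP[/Hu[h1 h2] /Hv[h3 h4]]; split => //; apply/andP.
Qed.

Lemma central_gap_free (Omega : set R) t : central_gap (ess_boundary Omega) t ->
  ~ ess_boundary Omega t.
Proof.
move=> [Dt h1 h2] Et; have [t0|t0] := leP 0 t.
  by have := h2 t Et Dt t0; rewrite ltxx.
by have := h1 t Et Dt t0; rewrite ltxx.
Qed.

Lemma in_support0 : D 0.
Proof. exact: density_gt0 density0_gt0. Qed.

(** HL and HR are the left and right half-lines, p and q are the masses of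
    Omega on the negative and on the nonnegative axis, s and t the masses of HR
    and HL outside Omega. The masses of Omega beyond the first boundary points
    are at most those of the half-lines, and J increases on [0, 1/2]. *)
Lemma null_center_structure (Omega : set R) : mble Omega ->
  (perimeter f Omega < +oo)%E ->
  leb.-negligible (Omega `&` central_gap (ess_boundary Omega)) ->
  exists (HL HR : set R) (p q s t : R),
    [/\ [/\ mble HL, mble HR, upward (- 1) HL & upward 1 HR],
        [/\ 0 <= p <= 1 / 2, 0 <= q <= 1 / 2, 0 <= s <= 1 / 2 & 0 <= t <= 1 / 2],
        p + q = m Omega,
        m (Omega `+` HR) <= p + s /\ m (Omega `+` HL) <= q + t &
        ((J p + J q + J s + J t)%:E <= perimeter f Omega)%E].
Proof.
move=> mO fin null; set E := ess_boundary Omega in fin null.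
pose SR : set R := [set u | 0 <= u]; pose SL : set R := [set u | u < 0].
have mSR : mble SR.
  have -> : SR = `[0, +oo[%classic.
    by apply/seteqP; split => u; rewrite /SR/= in_itv/= andbT.
  exact: itv_lebesgue_measurable.
have SLR : SL = ~` SR.
  apply/seteqP; split => u; rewrite /SL/SR/=.
    by rewrite ltNge => /negP.
  by move/negP; rewrite -ltNge.
have mSL : mble SL by rewrite SLR; exact: measurableC.
have D0 := in_support0.
have [HR [mHR uHR nR hR JR]] : exists H : set R, [/\ mble H, upward 1 H,
    mu.-negligible ((Omega `&` SR) `\` H), m H <= 1 / 2 &
    ((J (m H) + J (m (H `\` Omega)))%:E <= \esum_(u in E `&` SR) (f u)%:E)%E].
  have [y [y0 Dy Hy]] : exists y, [/\ 0 < y, D y &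
      forall e, E e -> D e -> e < 0 -> e <= - y].
    pose T := [set e | [/\ E e, D e & e < 0]].
    have TE : T `<=` E `&` D by move=> e [].
    have [T0|/set0P/(boundary_innermost fin TE)[e0 [Ee De e0neg] He]] := eqVneq T set0.
      have [_ [y [_ Dy _ y0]]] := open_itv_neighbours D0; exists y; split => //.
      by move=> e Ee De eneg; have : T e by []; rewrite T0.
    exists (- e0); split; [lra|by apply: open_itvN; rewrite opprK|].
    move=> e Ee' De' eneg; rewrite opprK.
    by have := He e (And3 Ee' De' eneg); rewrite !ltr0_norm// lerN2.
  apply: (half_line_side (or_introl erefl) mO mSR _ _ null (ltW y0) Dy _ _ fin).
  - by move=> u; rewrite mul1r.
  - by move=> u; rewrite mul1r => /ltW.
  - by move=> u Su; rewrite mul1r; apply: lt_le_trans Su; lra.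
  - move=> u Du; rewrite mul1r => yu He; split => //.
      by move=> e Ee De eneg; apply: le_lt_trans yu; exact: Hy.
    by move=> e Ee De epos; have := He e Ee De epos; rewrite mul1r.
have [HL [mHL uHL nL hL JL]] : exists H : set R, [/\ mble H, upward (- 1) H,
    mu.-negligible ((Omega `&` SL) `\` H), m H <= 1 / 2 &
    ((J (m H) + J (m (H `\` Omega)))%:E <= \esum_(u in E `&` SL) (f u)%:E)%E].
  have [y [y0 Dy Hy]] : exists y, [/\ 0 <= y, D y &
      forall e, E e -> D e -> 0 <= e -> y <= e].
    pose T := [set e | [/\ E e, D e & 0 <= e]].
    have TE : T `<=` E `&` D by move=> e [].
    have [T0|/set0P/(boundary_innermost fin TE)[e0 [Ee De e0pos] He]] := eqVneq T set0.
      exists 0; split => //.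
    exists e0; split => //.
    move=> e Ee' De' epos.
    by have := He e (And3 Ee' De' epos); rewrite !ger0_norm.
  apply: (half_line_side (or_intror erefl) mO mSL _ _ null y0 Dy _ _ fin).
  - by move=> u; rewrite /SL/= mulN1r; lra.
  - by move=> u; rewrite /SL/= mulN1r; lra.
  - by move=> u; rewrite /SL/= mulN1r; lra.
  - move=> u Du; rewrite mulN1r ltrN2 => uy He; split => //.
      by move=> e Ee De eneg; have := He e Ee De eneg; rewrite !mulN1r ltrN2.
    by move=> e Ee De epos; apply: lt_le_trans uy _; exact: Hy.
have mOR : mble (Omega `&` SR) by exact: measurableI.
have mOL : mble (Omega `&` SL) by exact: measurableI.
have le_null (A H : set R) : mble A -> mble H -> mu.-negligible (A `\` H) -> m A <= m H.
  move=> mA mH nAH.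
  rewrite (prob_split mA mH) (prob_negligible (measurableD mA mH) nAH) addr0.
  by apply: le_prob => //; exact: measurableI.
have qle := le_null _ _ mOR mHR nR.
have ple := le_null _ _ mOL mHL nL.
have splitO : m Omega = m (Omega `&` SL) + m (Omega `&` SR).
  by rewrite (prob_split mO mSR) addrC SLR setDE.
have mHRO := measurableD mHR mO; have mHLO := measurableD mHL mO.
have dle (H : set R) : mble H -> m (H `\` Omega) <= m H.
  by move=> mH; apply: le_prob => //; exact: measurableD.
have m0 (A : set R) : 0 <= m A by exact: fine_ge0.
exists HL, HR, (m (Omega `&` SL)), (m (Omega `&` SR)).
exists (m (HR `\` Omega)), (m (HL `\` Omega)).
split => //.
- by split; rewrite m0/=; [lra|lra| |];
    [apply: le_trans (dle _ mHR) hR|apply: le_trans (dle _ mHL) hL].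
- have far (A B H : set R) : mble A -> mble B -> mble H -> Omega = A `|` B ->
      mu.-negligible (B `\` H) -> m (Omega `+` H) <= m A + m (H `\` Omega).
    move=> mA mB mH OAB nBH; rewrite prob_setY// lerD2r.
    have mBH := measurableD mB mH.
    rewrite -[leRHS]addr0 -(prob_negligible mBH nBH).
    apply: le_trans (probU_le mA mBH); apply: le_prob.
    + exact: measurableD.
    + exact: measurableU.
    + by rewrite OAB => u [[Au|Bu] Hu]; [left|right].
  have OLR : Omega = (Omega `&` SL) `|` (Omega `&` SR).
    by rewrite -setIUr SLR setUC setUv setIT.
  split; first exact: far nR.
  by apply: far nL => //; rewrite setUC.
- have -> : perimeter f Omega =
      (\esum_(u in E `&` SR) (f u)%:E + \esum_(u in E `&` SL) (f u)%:E)%E.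
    rewrite SLR -(esumID SR)// => u _.
    by rewrite lee_fin density_ge0.
  apply: le_trans (leeD JR JL); rewrite -EFinD lee_fin.
  have := @J_nondecreasing (m (Omega `&` SR)) (m HR) (m0 _) qle hR.
  have := @J_nondecreasing (m (Omega `&` SL)) (m HL) (m0 _) ple hL.
  lra.
Qed.

(** If Omega is full in the central gap, the previous lemma is applied to its
    complement, which has the same boundary, and a half-line close to the
    complement is exchanged with its own complement. *)
Lemma deficit_asymmetry_structure (Omega : set R) : mble Omega ->
  (perimeter f Omega < +oo)%E ->
  exists p q s t : R,
    [/\ [/\ 0 <= p <= 1 / 2, 0 <= q <= 1 / 2, 0 <= s <= 1 / 2 & 0 <= t <= 1 / 2],
        (asymmetry mu a b Omega <= (2 * (p + s))%:E)%E,
        (asymmetry mu a b Omega <= (2 * (q + t))%:E)%E &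
        ((J p + J q + J s + J t - J (p + q))%:E <= deficit mu f a b Omega)%E].
Proof.
move=> mO fin; have [u [v uv]] := central_gap_itv fin.
have fin_per : perimeter f Omega \is a fin_num.
  by rewrite ge0_fin_numE// esum_ge0// => w _; rewrite lee_fin density_ge0.
have [|null|full] := null_or_full_negligible mO uv.
- by move=> w; exact: central_gap_free.
- have [HL [HR [p [q [s [t [[mHL mHR uHL uHR] bnds pq [dR dL] P]]]]]]] :=
    null_center_structure mO fin null.
  exists p, q, s, t; split => //.
  + apply: le_trans (asymmetry_le_half_line (or_introl erefl) mO mHR uHR) _.
    by rewrite lee_fin; lra.
  + apply: le_trans (asymmetry_le_half_line (or_intror erefl) mO mHL uHL) _.
    by rewrite lee_fin; lra.
  + by rewrite /deficit EFinB pq leeB.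
- have mC := measurableC mO.
  rewrite -(ess_boundary_setC mO) in full.
  have PC : perimeter f (~` Omega) = perimeter f Omega.
    by rewrite /perimeter ess_boundary_setC.
  have finC : (perimeter f (~` Omega) < +oo)%E by rewrite PC.
  have [HL [HR [p [q [s [t [[mHL mHR uHL uHR] bnds pq [dR dL] P]]]]]]] :=
    null_center_structure mC finC full.
  have setYC2 (H : set R) : Omega `+` ~` H = ~` Omega `+` H.
    apply/seteqP; split => w /= [[h1 h2]|[h1 h2]].
    - by right; split; [exact: contrapT|exact].
    - by left; split.
    - by right; split.
    - by left; split; [exact: contrapT|exact].
  exists p, q, s, t; split => //.
  + have := asymmetry_le_half_line (or_intror erefl) mO (measurableC mHR) (upwardC uHR).
    by rewrite setYC2 => h; apply: le_trans h _; rewrite lee_fin; lra.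
  + have uHL' := upwardC uHL; rewrite opprK in uHL'.
    have := asymmetry_le_half_line (or_introl erefl) mO (measurableC mHL) uHL'.
    by rewrite setYC2 => h; apply: le_trans h _; rewrite lee_fin; lra.
  + by rewrite /deficit EFinB pq probC// J_symmetric leeB// -PC.
Qed.

Lemma asymmetry_small eps : 0 < eps ->
  (forall s t : R, 0 < s -> s < t -> t < eps -> J t / t < J s / s) ->
  forall eta : R, 0 < eta -> exists2 delta : R, 0 < delta &
    forall Omega : set R, mble Omega -> (deficit mu f a b Omega < delta%:E)%E ->
      (asymmetry mu a b Omega < eta%:E)%E.
Proof.
move=> eps0 decr eta eta0; have eta4 : 0 < eta / 4 by lra.
have J0 : J 0 = 0 by rewrite J_outside// ltxx.
have [d1 d10 H1] := strict_subadditivity J0 J_support eps0 decr eta4.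
have [d2 d20 H2] := profile_small_arg J_gt0 J_nondecreasing eta4.
exists (Num.min d1 d2); first by rewrite lt_min d10.
move=> Omega mO small.
have fin : (perimeter f Omega < +oo)%E.
  rewrite ltey; apply/eqP => P; move: small.
  by rewrite /deficit P /= ltNge leey.
have [p [q [s [t [[p01 q01 s01 t01] A1 A2 def]]]]] := deficit_asymmetry_structure mO fin.
have := le_lt_trans def small; rewrite lte_fin lt_min => /andP[h1 h2].
have sub := subadditivity J0 J_support p01 q01.
have Js := J_ge0 s; have Jt := J_ge0 t.
have s_small : s < eta / 4 by apply: H2 => //; lra.
have t_small : t < eta / 4 by apply: H2 => //; lra.
have [p_small|q_small] := H1 p q p01 q01 ltac:(lra).
  by apply: le_lt_trans A1 _; rewrite lte_fin; lra.
by apply: le_lt_trans A2 _; rewrite lte_fin; lra.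
Qed.

Lemma asymmetry_cvg0 eps (Omega : nat -> set R) : 0 < eps ->
  (forall s t : R, 0 < s -> s < t -> t < eps -> J t / t < J s / s) ->
  (forall n, mble (Omega n)) ->
  deficit mu f a b (Omega n) @[n --> \oo] --> 0%E ->
  asymmetry mu a b (Omega n) @[n --> \oo] --> 0%E.
Proof.
move=> eps0 decr mO cvg0.
have A0 n : (0 <= asymmetry mu a b (Omega n))%E by rewrite le_min !measure_ge0.
have near_small eta : 0 < eta ->
    \forall n \near \oo, (asymmetry mu a b (Omega n) < eta%:E)%E.
  move=> eta0; have [d d0 Hd] := asymmetry_small eps0 decr eta0.
  have [fin_def /cvgrPdist_lt/(_ d d0) small] := (fine_cvgP _ _).1 cvg0.
  apply: filterS2 fin_def small => n fin_n; rewrite /= sub0r normrN => small_n.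
  apply: Hd => //; rewrite -(fineK fin_n) lte_fin.
  exact: le_lt_trans (ler_norm _) small_n.
apply/fine_cvgP; split.
  apply: filterS (near_small 1 ltr01) => n h.
  by rewrite ge0_fin_numE//; apply: lt_trans h _; rewrite ltry.
apply/cvgrPdist_lt => e e0; apply: filterS (near_small e e0) => n h.
have fin : asymmetry mu a b (Omega n) \is a fin_num.
  by rewrite ge0_fin_numE//; apply: lt_trans h _; rewrite ltry.
by rewrite /= sub0r normrN ger0_norm ?fine_ge0// -lte_fin fineK.
Qed.

End log_concave_measure.

Theorem theorem3p5 (R : realType) (mu : probability (lebesgueTypeR R) R)
    (f : R -> R) (a b : \bar R)
    (f_density : has_density mu f)
    (f_pos : forall x : R, open_itv a b x -> 0 < f x)
    (f_zero : forall x : R, ~ open_itv a b x -> f x = 0)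
    (f_log_concave : log_concave_on (open_itv a b) f)
    (f_symmetric : forall x : R, f (- x) = f x)
    (J_decreasing : exists2 eps : R, 0 < eps &
      forall s t : R, 0 < s -> s < t -> t < eps ->
        J mu f a b t / t < J mu f a b s / s)
    (Omega : nat -> set R)
    (Omega_measurable : forall n, measurable (Omega n : set (lebesgueTypeR R)))
    (deficit_to0 : deficit mu f a b (Omega n) @[n --> \oo] --> 0%E) :
  asymmetry mu a b (Omega n) @[n --> \oo] --> 0%E.
Proof.
have [eps eps0 decr] := J_decreasing.
exact: (asymmetry_cvg0 f_density f_pos f_zero f_log_concave f_symmetric
  eps0 decr Omega_measurable deficit_to0).
Qed.
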